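(* The space $X_{ius}$ is unconditionally saturated: every infinite dimensional closed subspace of $X_{ius}$ contains an unconditional basic sequence.
   Context: Scalars are real, $\mathbb{N}=\{1,2,\dots\}$. $c_{00}$ is the space of finitely supported sequences, with standard basis $(e_n)$, also written $(e_n^* )$ when its elements are viewed as functionals; $f(x)=\langle f,x\rangle=\sum_n f(n)x(n)$, $\|f\|_\infty=\max_n|f(n)|$. $\operatorname{supp}x=\{n:x(n)\ne 0\}$, $\operatorname{range}(x)$ is the smallest interval of $\mathbb{N}$ containing $\operatorname{supp}x$. For sets, $A<B$ means $\max A<\min B$; $x<y$ means $\operatorname{supp}x<\operatorname{supp}y$. For an interval $E\subset\mathbb{N}$, $Ex$ is the restriction of $x$ to $E$. Fix positive integers $m_j,n_j,s_j$ with $m_1=2$, $m_{j+1}=m_j^5$, $n_1=4$, $n_{j+1}=(4n_j)^{s_j}$, $2^{s_j}\ge m_{j+1}^3$. Let $\mathbf{Q}$ be the set of sequences with finite nonempty support, rational coordinates, all of modulus at most $1$, and $\mathbf{Q_s}$ the set of all $(x_1,f_1,\dots,x_n,f_n)$ with $x_i,f_i\in\mathbf{Q}$ and $\operatorname{range}(x_i)\cup\operatorname{range}(f_i)<\operatorname{range}(x_{i+1})\cup\operatorname{range}(f_{i+1})$ for $i<n$. Fix an injection $\sigma:\mathbf{Q_s}\to\{2j:j\in\mathbb{N}\}$ such that for every $\phi=(x_1,f_1,\dots,x_n,f_n)\in\mathbf{Q_s}$: $\sigma(x_1,f_1,\dots,x_{n-1},f_{n-1})<\sigma(\phi)$ and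 $\max\{\operatorname{range}(x_n)\cup\operatorname{range}(f_n)\}\le m_{\sigma(\phi)}^{1/2}$. Special sequences: $\phi=(x_1,f_1,\dots,x_{2k},f_{2k})\in\mathbf{Q_s}$, with $\phi_i=(x_1,f_1,\dots,x_i,f_i)$, is a special sequence of length $2k$ if: (1) for some $j\in\mathbb{N}$ with $m_{2j}^{1/2}>2k$, $x_1=\frac1{n_{2j}}\sum_{l=1}^{n_{2j}}e_{1,l}$ and $f_1=\frac1{m_{2j}}\sum_{l=1}^{n_{2j}}e^*_{1,l}$, where $(e_{1,l})_l$ are $n_{2j}$ distinct standard basis vectors; (2) for $1\le i\le k$, $\|f_{2i}\|_\infty\le\frac1{m_{\sigma(\phi_{2i-1})}}$ and $|f_{2i}(x_{2i})|\le\frac1{m_{\sigma(\phi_{2i-1})}}$; (3) for $1\le i<k$, with $p=\sigma(\phi_{2i})$, $x_{2i+1}=\frac1{n_p}\sum_{l=1}^{n_p}e_{2i+1,l}$ and $f_{2i+1}=\frac1{m_p}\sum_{l=1}^{n_p}e^*_{2i+1,l}$, where $(e_{2i+1,l})_l$ are $n_p$ distinct standard basis vectors. Norming set: $K_0=K_0^0=\{\pm e_n^*:n\in\mathbb{N}\}$, $K_0^j=\emptyset$ for $j\ge1$, and $K_n^0=K_0$ for all $n$. For $n\ge1$, $j\in\mathbb{N}$: $K_n^{2j}=K_{n-1}^{2j}\cup\{\frac1{m_{2j}}\sum_{i=1}^d f_i:d\le n_{2j},\ f_1<\dots<f_d,\ f_i\in K_{n-1}\}$. For a special sequence $\phi=(x_1,f_1,\dots,x_{n_{2j+1}},f_{n_{2j+1}})$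 of length $n_{2j+1}$ with $f_{2i}\in K_{n-1}^{\sigma(\phi_{2i-1})}$ for $i\le n_{2j+1}/2$, $K_{n,\phi}^{2j+1}$ is the set of all $\frac{\pm1}{m_{2j+1}}E\bigl(\sum_{i=1}^{n_{2j+1}/2}(\lambda_{f'_{2i}}f_{2i-1}+f'_{2i})\bigr)$, where $E$ is an interval, $f'_{2i}\in K_{n-1}^{\sigma(\phi_{2i-1})}$, $\operatorname{supp}f'_{2i}=\operatorname{supp}f_{2i}$, $|g(x_{2i})|\le\frac1{m_{\sigma(\phi_{2i-1})}}$ for all $g\in K_{n-1}^{\sigma(\phi_{2i-1})}$, and $\lambda_{f'_{2i}}=f'_{2i}(m_{\sigma(\phi_{2i-1})}x_{2i})$ if $f'_{2i}(x_{2i})\ne0$, $\lambda_{f'_{2i}}=\pm\frac1{n_{2j+1}^2}$ otherwise. $K_n^{2j+1}$ is the union of $K_{n-1}^{2j+1}$ and all $K_{n,\phi}^{2j+1}$, $\phi$ a special sequence of length $n_{2j+1}$. $K_n=\bigcup_jK_n^j$, $K=\bigcup_nK_n$. $X_{ius}$ is the completion of $c_{00}$ under $\|x\|=\|x\|_K=\sup\{f(x):f\in K\}$. *)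

(* Defs.v *)
From HB Require Import structures.
From mathcomp Require Export all_boot all_order all_algebra.
From mathcomp Require Export all_classical all_reals all_analysis.
Export Order.TTheory GRing.Theory Num.Theory numFieldNormedType.Exports.

Set Implicit Arguments.
Unset Strict Implicit.
Unset Printing Implicit Defensive.

Local Open Scope classical_set_scope.
Local Open Scope ring_scope.

(* Vectors and functionals are both functions nat -> R.  Coordinates are
   numbered from 1, so that elements of c00 vanish at 0. *)

Section Sequences.
Variable R : realType.
Implicit Types (x f : nat -> R) (A B E : set nat).

Definition supp x : set nat := [set k | x k != 0].

Definition c00 : set (nat -> R) := [set x | x 0%N = 0 /\ finite_set (supp x)].

Definition basis_vec (k : nat) : nat -> R := fun i => (i == k)%:R.

(* The sum is over the finite support of the summand. *)
Definition pairing f x : R := \sum_(k \in [set: nat]) f k * x k.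

Definition sup_norm f : R := sup (range (fun k => `|f k|)).

Definition nat_interval E : Prop :=
  forall a b c, E a -> E b -> (a <= c <= b)%N -> E c.

Definition hull x : set nat := smallest nat_interval (supp x).

Definition set_before A B : Prop := forall a b, A a -> B b -> (a < b)%N.

(* Pairwise, and not only for consecutive indices: the two differ when some of
   the f i are zero. *)
Definition successive (d : nat) (f : 'I_d -> nat -> R) : Prop :=
  forall i j : 'I_d, (i < j)%N -> set_before (supp (f i)) (supp (f j)).

End Sequences.

Definition admissible_parameters (m n s : nat -> nat) : Prop :=
  [/\ m 1%N = 2%N, n 1%N = 4%N &
   forall j, (0 < j)%N ->
     [/\ [/\ (0 < m j)%N, (0 < n j)%N & (0 < s j)%N],
         m j.+1 = (m j ^ 5)%N,
         n j.+1 = ((4 * n j) ^ s j)%N &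
         (m j.+1 ^ 3 <= 2 ^ s j)%N]].

Section NormingSet.
Variable R : realType.
Variables m n : nat -> nat.

Definition block_seq := seq ((nat -> R) * (nat -> R)).

Implicit Types (x f g : nat -> R) (phi : block_seq).

(* x_i and f_i of phi = (x_1, f_1, x_2, f_2, ...), for i >= 1 *)
Definition vec phi (i : nat) : nat -> R := (nth (0, 0) phi i.-1).1.
Definition func phi (i : nat) : nat -> R := (nth (0, 0) phi i.-1).2.

Definition Q : set (nat -> R) :=
  [set x | [/\ c00 x, supp x !=set0, forall k, range (@ratr R) (x k) &
              forall k, `|x k| <= 1]].

Definition joint_hull phi i : set nat := hull (vec phi i) `|` hull (func phi i).

Definition Qs : set block_seq :=
  [set phi | [/\ (0 < size phi)%N,
     forall i, (1 <= i <= size phi)%N -> Q (vec phi i) /\ Q (func phi i) &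
     forall i, (1 <= i < size phi)%N ->
       set_before (joint_hull phi i) (joint_hull phi i.+1)]].

Definition coding_function (sigma : block_seq -> nat) : Prop :=
  {in Qs &, injective sigma} /\
  forall phi, Qs phi ->
    [/\ exists2 j, (0 < j)%N & sigma phi = j.*2,
        (1 < size phi)%N ->
          (sigma (take (size phi).-1 phi) < sigma phi)%N &
        forall k, joint_hull phi (size phi) k ->
          k%:R <= Num.sqrt (m (sigma phi))%:R :> R].

Variable sigma : block_seq -> nat.

Definition basis_average (p : nat) x f : Prop :=
  exists t : 'I_(n p) -> nat,
    [/\ injective t, forall l, (0 < t l)%N,
        x = (n p)%:R^-1 *: \sum_(l < n p) basis_vec R (t l) &
        f = (m p)%:R^-1 *: \sum_(l < n p) basis_vec R (t l)].

Definition special_sequence (k : nat) phi : Prop :=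
  [/\ (0 < k)%N, Qs phi & size phi = k.*2] /\
  [/\ exists j, [/\ (0 < j)%N, (k.*2)%:R < Num.sqrt (m j.*2)%:R :> R &
                    basis_average j.*2 (vec phi 1) (func phi 1)],
      forall i, (1 <= i <= k)%N ->
        let w := (m (sigma (take i.*2.-1 phi)))%:R^-1 : R in
        sup_norm (func phi i.*2) <= w /\
        `|pairing (func phi i.*2) (vec phi i.*2)| <= w &
      forall i, (1 <= i < k)%N ->
        basis_average (sigma (take i.*2 phi))
          (vec phi i.*2.+1) (func phi i.*2.+1)].

Definition K0 : set (nat -> R) :=
  [set f | exists2 k, (0 < k)%N & f = basis_vec R k \/ f = - basis_vec R k].

(* In the next two definitions L j stands for K_(r-1)^j. *)

Definition even_step (L : nat -> set (nat -> R)) (p : nat) : set (nat -> R) :=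
  [set f | exists d (h : 'I_d -> nat -> R),
     [/\ (1 <= d <= n p)%N, successive h,
         forall i, (\bigcup_j L j) (h i) &
         f = (m p)%:R^-1 *: \sum_(i < d) h i]].

Definition odd_step_at (L : nat -> set (nat -> R)) (p : nat) phi :
    set (nat -> R) :=
  let code i := sigma (take i.*2.-1 phi) in
  let k := (n p)./2 in
  [set f | exists (b : bool) (E : set nat) (f' : nat -> nat -> R)
             (lam : nat -> R),
     [/\ nat_interval E,
         forall i, (1 <= i <= k)%N ->
           [/\ L (code i) (f' i), supp (f' i) = supp (func phi i.*2),
               forall g, L (code i) g ->
                 `|pairing g (vec phi i.*2)| <= (m (code i))%:R^-1 &
               if pairing (f' i) (vec phi i.*2) != 0
               then lam i = pairing (f' i) ((m (code i))%:R *: vec phi i.*2)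
               else lam i = ((n p)%:R ^+ 2)^-1 \/
                    lam i = - ((n p)%:R ^+ 2)^-1] &
         f = ((-1) ^+ b / (m p)%:R) *:
             ((\sum_(1 <= i < k.+1) (lam i *: func phi i.*2.-1 + f' i)) \_ E)]].

Definition odd_step (L : nat -> set (nat -> R)) (p : nat) : set (nat -> R) :=
  [set f | exists phi,
     [/\ special_sequence (n p)./2 phi, size phi = n p,
         forall i, (1 <= i <= (n p)./2)%N ->
           L (sigma (take i.*2.-1 phi)) (func phi i.*2) &
         odd_step_at L p phi f]].

(* Klev r p is K_r^p.  The odd indices carrying functionals are the
   2j+1 with j >= 1, so that K_r^1 stays empty. *)
Fixpoint Klev (r p : nat) : set (nat -> R) :=
  if p == 0%N then K0 else
  match r with
  | 0 => set0
  | r'.+1 =>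
      Klev r' p `|`
      (if ~~ odd p then even_step (Klev r') p
       else if (3 <= p)%N then odd_step (Klev r') p else set0)
  end.

Definition K : set (nat -> R) := \bigcup_r \bigcup_p Klev r p.

Definition normK x : R := sup [set pairing f x | f in K].

End NormingSet.

Definition is_completion (R : realType) (N : (nat -> R) -> R)
    (X : completeNormedModType R) (iota : (nat -> R) -> X) : Prop :=
  [/\ forall (a : R) x y, c00 x -> c00 y ->
        iota (a *: x + y) = a *: iota x + iota y,
      forall x, c00 x -> `|iota x| = N x &
      dense (iota @` @c00 R)].

Section UnconditionalSaturation.
Variables (R : realType) (X : normedModType R).
Implicit Types (y : nat -> X) (Y : set X).

Definition finite_dimensional Y : Prop :=
  exists d (v : 'I_d -> X), (forall i, Y (v i)) /\
    forall z, Y z -> exists a : 'I_d -> R, z = \sum_(i < d) a i *: v i.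

Definition linear_span y : set X :=
  [set z | exists d (a : nat -> R), z = \sum_(i < d) a i *: y i].

Definition expansion (a : nat -> R) y : nat -> X :=
  series (fun k => a k *: y k).

Definition basic_sequence y : Prop :=
  forall z, closure (linear_span y) z ->
    exists! a : nat -> R, expansion a y @ \oo --> z.

(* Unconditional: every convergent expansion converges after any
   rearrangement of its terms. *)
Definition unconditional_basic_sequence y : Prop :=
  basic_sequence y /\
  forall a : nat -> R, cvgn (expansion a y) ->
    forall pi : nat -> nat, bijective pi -> cvgn (expansion (a \o pi) (y \o pi)).

Definition unconditionally_saturated : Prop :=
  forall Y, submod_closed (mem Y) -> closed Y -> ~ finite_dimensional Y ->
    exists2 y, (forall k, Y (y k)) & unconditional_basic_sequence y.

End UnconditionalSaturation.

(* Main.v *)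
Require Import Defs.
From mathcomp Require Import zify lra ring.

Set Implicit Arguments.
Unset Strict Implicit.
Unset Printing Implicit Defensive.
Local Open Scope classical_set_scope.
Local Open Scope ring_scope.

(** Call m_p^-1 * sum_(l < n_p) |x (t l)|, for p even and positive and t
injective, an average of x.  Averages depend only on |x| and are bounded by
the norm (average_le_normK), because m_p^-1 * sum_l +-e*_(t l) lies in K.  The
functionals f_(2i-1) of a special sequence are bounded by averages too.

In a closed infinite dimensional subspace Y there are two cases.

- The averages detect the norm of all the vectors of Y whose first N
coordinates vanish.  On such vectors the norm is then equivalent to the
supremum of the averages, which does not see signs, so a sequence in Y close
enough to a block sequence is unconditional (saturated_large_averages).

- Otherwise Y contains small perturbations of normalized blocks u_k of which
all averages are as small as desired, say at most d_k.  Given signs eps_k, any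
f in K can then be replaced by some g in K with |g(u_k) - eps_k f(u_k)| <= d_k
for all k (sign_change).  The functional g is built along the construction of
f, with the same supports.  A piece of f which meets a single block just has
its sign changed, which is possible since K is symmetric and, in the odd
steps, since changing the sign of f'_(2i) also changes that of its coefficient
lambda.  Pieces which meet several blocks are treated by induction; in an odd
step their new coefficient lambda cannot be prescribed, but the error this
makes on u_k is at most 2 |f_(2i-1)(u_k)| <= 2 d_k.  The pieces are successive,
so among those which meet u_k at most two meet another block
(pairing_pieces), and the weight 1/m_p <= 1/6 absorbs the resulting factor
2 * 3 (saturated_small_averages).

Either way a normalized sequence in Y satisfies
|sum_i eps_i a_i y_i| <= C |sum_i a_i y_i| + max_i |a_i|.  Changing the sign of
the largest coefficient only shows that max_i |a_i| is itself bounded by a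
multiple of |sum_i a_i y_i|, so the last term can be dropped, and the sequence
is unconditional basic (almost_sign_invariant_unconditional). *)

(** * The pairing of finitely supported vectors *)

Section Pairing.
Variable R : realType.
Implicit Types f g u x : nat -> R.

Lemma pairing_ord N f x : (forall c, (N <= c)%N -> x c = 0) ->
  pairing f x = \sum_(c < N) f c * x c.
Proof.
move=> x0; rewrite /pairing (fsbig_ord _ _ (fun c => f c * x c)); symmetry.
apply: fsbig_widen => // c [_ /= /negP]; rewrite -leqNgt => /x0 ->.
by rewrite mulr0.
Qed.

Lemma c00_eventually0 x : c00 x -> exists N, forall c, (N <= c)%N -> x c = 0.
Proof.
case=> _ /finite_seqP[s xs]; exists (\max_(i <- s) i).+1 => c hc.
apply/eqP/negPn/negP => xc; have : [set` s] c by rewrite -xs.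
by move=> /= cs; have /= := @leq_bigmax_seq _ s predT id c cs isT; rewrite leqNgt hc.
Qed.

Lemma c00_of_tail x N : x 0%N = 0 -> (forall c, (N <= c)%N -> x c = 0) -> c00 x.
Proof.
move=> x0 xN; split=> //; apply: (@sub_finite_set _ _ `I_N); last exact: finite_II.
by move=> c /= xc; rewrite ltnNge; apply: contra xc => /xN ->.
Qed.

Lemma c00_lin (a : R) x y : c00 x -> c00 y -> c00 (a *: x + y).
Proof.
move=> cx cy; have [[x0 _] [y0 _]] := (cx, cy).
have [[N hN] [M hM]] := (c00_eventually0 cx, c00_eventually0 cy).
apply: (@c00_of_tail _ (maxn N M)) => [|c].
  by rewrite !fctE x0 y0 scaler0 addr0.
by rewrite geq_max !fctE => /andP[/hN -> /hM ->]; rewrite scaler0 addr0.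
Qed.

Lemma c00_0 : c00 (0 : nat -> R).
Proof. exact: (@c00_of_tail _ 0). Qed.

Lemma c00_D x y : c00 x -> c00 y -> c00 (x + y).
Proof. by move=> cx cy; have := c00_lin 1 cx cy; rewrite scale1r. Qed.

Lemma c00_Z a x : c00 x -> c00 (a *: x).
Proof. by move=> cx; have := c00_lin a cx c00_0; rewrite addr0. Qed.

Lemma c00_B x y : c00 x -> c00 y -> c00 (x - y).
Proof. by move=> cx cy; rewrite -scaleN1r addrC; apply: c00_lin. Qed.

Lemma c00_sum (I : Type) (r : seq I) (F : I -> nat -> R) :
  (forall i, c00 (F i)) -> c00 (\sum_(i <- r) F i).
Proof. by move=> cF; apply: big_ind => //; [exact: c00_0 | exact: c00_D]. Qed.

Lemma c00_restrict E x : c00 x -> c00 (x \_ E).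
Proof.
move=> cx; have [N hN] := c00_eventually0 cx; apply: (@c00_of_tail _ N) => [|c hc].
  by rewrite patchE cx.1; case: ifP.
by rewrite patchE hN //; case: ifP.
Qed.

Lemma pairing_restrict E f x : pairing (f \_ E) x = pairing f (x \_ E).
Proof.
apply: eq_fsbigr => c _; rewrite !patchE; case: ifP => // _.
by rewrite mul0r mulr0.
Qed.

Lemma pairing_eq0 f x : (forall c, f c * x c = 0) -> pairing f x = 0.
Proof. by move=> h; apply: fsbig1 => c _. Qed.

Section Fixed.
Variables (x : nat -> R) (cx : c00 x).

Lemma pairingD f g : pairing (f + g) x = pairing f x + pairing g x.
Proof.
have [N hN] := c00_eventually0 cx; rewrite !(pairing_ord _ hN) -big_split.
by apply: eq_bigr => c _; rewrite mulrDl.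
Qed.

Lemma pairingZ a f : pairing (a *: f) x = a * pairing f x.
Proof.
have [N hN] := c00_eventually0 cx; rewrite !(pairing_ord _ hN) mulr_sumr.
by apply: eq_bigr => c _; rewrite mulrA.
Qed.

Lemma pairingN f : pairing (- f) x = - pairing f x.
Proof. by rewrite -scaleN1r pairingZ mulN1r. Qed.

Lemma pairing0 : pairing 0 x = 0.
Proof. by apply: pairing_eq0 => c; rewrite mul0r. Qed.

Lemma pairing_sum (I : Type) (r : seq I) (F : I -> nat -> R) :
  pairing (\sum_(i <- r) F i) x = \sum_(i <- r) pairing (F i) x.
Proof.
elim: r => [|i r IH]; first by rewrite !big_nil pairing0.
by rewrite !big_cons pairingD IH.
Qed.

Lemma pairingZr a f : pairing f (a *: x) = a * pairing f x.
Proof.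
have [N hN] := c00_eventually0 cx; rewrite !(pairing_ord (N := N)) // ?mulr_sumr.
  by apply: eq_bigr => c _; rewrite -[(a *: x) c]/(a * x c) mulrCA.
by move=> c hc; rewrite !fctE hN // scaler0.
Qed.

End Fixed.

Lemma pairingDr f x y : c00 x -> c00 y ->
  pairing f (x + y) = pairing f x + pairing f y.
Proof.
move=> /c00_eventually0[N hN] /c00_eventually0[M hM].
rewrite !(pairing_ord (N := maxn N M)) -?big_split.
- by apply: eq_bigr => c _; rewrite fctE mulrDr.
- by move=> c; rewrite geq_max => /andP[_ /hM].
- by move=> c; rewrite geq_max => /andP[/hN].
- by move=> c; rewrite geq_max fctE => /andP[/hN -> /hM ->]; rewrite addr0.
Qed.

Lemma pairing0r f : pairing f 0 = 0.
Proof. by apply: pairing_eq0 => c; rewrite mulr0. Qed.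

Lemma pairing_basis k x : c00 x -> pairing (basis_vec R k) x = x k.
Proof.
move=> /c00_eventually0[N hN]; rewrite (pairing_ord (N := maxn N k.+1)); last first.
  by move=> c; rewrite geq_max => /andP[/hN].
have kN : (k < maxn N k.+1)%N by rewrite leq_max leqnn orbT.
rewrite (bigD1 (Ordinal kN)) //= /basis_vec eqxx mul1r big1 ?addr0 // => i ik.
suff -> : (i == k :> nat) = false by rewrite mul0r.
by apply: contraNF ik => /eqP ik; apply/eqP/val_inj.
Qed.

Lemma pairing_sumr (I : Type) (r : seq I) f (F : I -> nat -> R) :
  (forall i, c00 (F i)) ->
  pairing f (\sum_(i <- r) F i) = \sum_(i <- r) pairing f (F i).
Proof.
move=> cF; elim: r => [|i r IH]; first by rewrite !big_nil pairing0r.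
by rewrite !big_cons pairingDr ?IH //; exact: c00_sum.
Qed.

(** Only the first and the last index with a nonzero term can contribute.
*)
Lemma sum_at_most_two_nat (N : nat) (F : nat -> R) (C : R) : 0 <= C ->
  (forall i, (i < N)%N -> F i <= C) ->
  (forall i j k, (i < j < k)%N -> (k < N)%N ->
     F i != 0 -> F j != 0 -> F k != 0 -> False) ->
  \sum_(0 <= i < N) F i <= 2 * C.
Proof.
move=> C0 FC F3.
suff [i [j hF]] : exists i j, forall l, (l < N)%N -> F l != 0 -> l = i \/ l = j.
  have le1 k : \sum_(0 <= l < N) (if l == k then C else 0) <= C.
    by rewrite -big_mkcond /= big_nat1_eq; case: ifP.
  rewrite (_ : 2 * C = C + C); last by ring.
  apply: le_trans (lerD (le1 i) (le1 j)); rewrite -big_split /=.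
  rewrite big_nat [leRHS]big_nat; apply: ler_sum => l /= lN.
  have [->|Fl] := eqVneq (F l) 0; first by do 2!case: ifP => _; lra.
  have := FC l lN; have [->|->] := hF l lN Fl; rewrite eqxx; case: ifP => _; lra.
have [h|h] := pselect (exists l, (l < N)%N && (F l != 0)); last first.
  by exists 0%N, 0%N => l lN Fl; exfalso; apply: h; exists l; rewrite lN.
have hub l : (l < N)%N && (F l != 0) -> (l <= N)%N by case/andP=> /ltnW.
exists (ex_minn h), (ex_maxn h hub).
case: ex_minnP => a /andP[aN Fa] amin; case: ex_maxnP => b /andP[bN Fb] bmax.
move=> l lN Fl.
have al : (a <= l)%N by apply: amin; rewrite lN.
have lb : (l <= b)%N by apply: bmax; rewrite lN.
have [->|la] := eqVneq l a; [by left|have [->|nlb] := eqVneq l b; first by right].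
exfalso; apply: (F3 a l b) => //.
by rewrite [(a < _)%N]ltn_neqAle eq_sym la al ltn_neqAle nlb lb.
Qed.

Lemma sum_at_most_two (N : nat) (F : 'I_N -> R) (C : R) : 0 <= C ->
  (forall i, F i <= C) ->
  (forall i j k : 'I_N, (i < j < k)%N ->
     F i != 0 -> F j != 0 -> F k != 0 -> False) ->
  \sum_(i < N) F i <= 2 * C.
Proof.
move=> C0 FC F3; pose F' i := oapp F 0 (insub i : option 'I_N).
have F'E (i : 'I_N) : F' i = F i by rewrite /F' valK.
have -> : \sum_(i < N) F i = \sum_(0 <= i < N) F' i.
  by rewrite big_mkord; apply: eq_bigr => i _; rewrite F'E.
apply: sum_at_most_two_nat => // [i iN|i j k /andP[ij jk] kN].
  by rewrite (F'E (Ordinal iN)).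
have jN := ltn_trans jk kN; have iN := ltn_trans ij jN.
rewrite (F'E (Ordinal iN)) (F'E (Ordinal jN)) (F'E (Ordinal kN)).
by apply: F3; rewrite /= ij.
Qed.

End Pairing.

(** * Successive families and colourings *)
Section Supports.
Variable R : realType.
Implicit Types f g u x : nat -> R.

Lemma eq0_notin_supp f c : ~ supp f c -> f c = 0.
Proof. by move=> h; apply/eqP/negPn/negP. Qed.

Lemma successive_uniq N (f : 'I_N -> nat -> R) c i j : successive f ->
  supp (f i) c -> supp (f j) c -> i = j.
Proof.
move=> sf fi fj; case: (ltngtP i j) => [ij|ji|/val_inj //].
- by have := sf _ _ ij _ _ fi fj; rewrite ltnn.
- by have := sf _ _ ji _ _ fj fi; rewrite ltnn.
Qed.

Lemma sum_successive N (f : 'I_N -> nat -> R) c i : successive f ->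
  supp (f i) c -> (\sum_(j < N) f j) c = f i c.
Proof.
move=> sf fi; rewrite fct_sumE (bigD1 i) //= big1 ?addr0 // => j ji.
by apply: eq0_notin_supp => fj; rewrite (successive_uniq sf fi fj) eqxx in ji.
Qed.

Lemma supp_sum_successive N (f : 'I_N -> nat -> R) : successive f ->
  supp (\sum_(j < N) f j) = \bigcup_i supp (f i).
Proof.
move=> sf; apply/seteqP; split=> c /=; last first.
  by case=> i _ fi; rewrite /supp /= (sum_successive sf fi).
move=> hc; apply: contrapT => h; move: hc.
rewrite /supp /= fct_sumE big1 ?eqxx // => i _.
by apply: eq0_notin_supp => fi; apply: h; exists i.
Qed.

Lemma successive_supp N (f g : 'I_N -> nat -> R) :
  (forall i, supp (g i) = supp (f i)) -> successive f -> successive g.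
Proof. by move=> gf sf i j ij; rewrite !gf; apply: sf. Qed.

Lemma supp_scale (a : R) f : a != 0 -> supp (a *: f) = supp f.
Proof.
move=> a0; apply/seteqP; split=> c /=; rewrite /supp /= !fctE /=;
  by rewrite mulf_eq0 (negPf a0).
Qed.

Lemma supp_restrict_eq E f g : supp f = supp g -> supp (f \_ E) = supp (g \_ E).
Proof.
move=> fg; apply/seteqP; split=> c; rewrite /supp /= !patchE; case: ifP => // _;
  by [move=> h; have : supp f c by []; rewrite fg | move=> h; have : supp g c by []; rewrite -fg].
Qed.

Lemma supp_opp f : supp (- f) = supp f.
Proof. by apply/seteqP; split=> c; rewrite /supp /= fctE oppr_eq0. Qed.

End Supports.

Section Colour.
Variables (R : realType) (col : nat -> nat) (eps : nat -> bool).
Hypothesis col_mono : {homo col : a b / (a <= b)%N}.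
Implicit Types f g u : nat -> R.

(** Colours number the blocks of a block sequence; a monotone colouring of the
coordinates lets vectors and pieces of functionals be compared with the blocks
without mentioning their ranges. *)
Definition monochromatic (S : set nat) := forall a b, S a -> S b -> col a = col b.

Definition coloured (k : nat) u := forall c, u c != 0 -> col c = k.

Lemma pairing_coloured0 k f u : coloured k u ->
  (forall c, supp f c -> col c <> k) -> pairing f u = 0.
Proof.
move=> uk fk; apply: pairing_eq0 => c.
have [->|uc] := eqVneq (u c) 0; first by rewrite mulr0.
rewrite (@eq0_notin_supp _ f c) ?mul0r // => /fk; apply; exact: uk.
Qed.

(** A functional supported in one colour only acts on one block, so its sign
can be chosen freely; one choice serves all functionals supported in S. *)
Lemma monochromatic_sign (S : set nat) : monochromatic S ->
  exists b : bool, forall f k u, supp f `<=` S -> c00 u -> coloured k u ->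
    pairing ((-1) ^+ b *: f) u = (-1) ^+ eps k * pairing f u.
Proof.
move=> mS; have [[a Sa]|S0] := pselect (S !=set0).
  exists (eps (col a)) => f k u fS cu uk; rewrite pairingZ //.
  have [->//|ak] := eqVneq k (col a).
  rewrite (pairing_coloured0 uk) ?mulr0 // => c /fS /(mS _ _ Sa) <-.
  by apply/eqP; rewrite eq_sym.
exists false => f k u fS cu uk; rewrite pairingZ // (pairing_coloured0 uk) ?mulr0 //.
by move=> c /fS Sc; case: S0; exists c.
Qed.

(** If i < j < l and the pieces f_i and f_l both meet colour k, then f_j lies
between two points of colour k and is monochromatic.  Hence at most two pieces
that meet colour k are not monochromatic, and only these carry an error. *)
Lemma pairing_pieces N (f g : 'I_N -> nat -> R) k u (C : R) : 0 <= C ->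
  c00 u -> coloured k u -> successive f -> (forall i, supp (g i) = supp (f i)) ->
  (forall i, `|pairing (g i) u - (-1) ^+ eps k * pairing (f i) u| <= C) ->
  (forall i, monochromatic (supp (f i)) ->
     pairing (g i) u = (-1) ^+ eps k * pairing (f i) u) ->
  `|pairing (\sum_(i < N) g i) u - (-1) ^+ eps k * pairing (\sum_(i < N) f i) u|
    <= 2 * C.
Proof.
move=> C0 cu uk sf gf gC gm; rewrite !pairing_sum // mulr_sumr -sumrB.
apply: le_trans (ler_norm_sum _ _ _) _; apply: sum_at_most_two => //.
(* A piece with an error meets colour k and is not monochromatic. *)
have nz i : `|pairing (g i) u - (-1) ^+ eps k * pairing (f i) u| != 0 ->
    ~ monochromatic (supp (f i)) /\ exists2 c, supp (f i) c & col c = k.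
  move=> h; split=> [/gm e|]; first by rewrite e subrr normr0 eqxx in h.
  apply: contrapT => h'; move/eqP: h; apply.
  rewrite !(pairing_coloured0 uk) ?mulr0 ?subr0 ?normr0 // => c; rewrite ?gf => fc ck;
    by apply: h'; exists c.
move=> i j l /andP[ij jl] /nz[_ [a fa ak]] /nz[njm _] /nz[_ [b fb bk]].
apply: njm => c c' fc fc'.
have E d : supp (f j) d -> col d = k.
  move=> fd; apply/eqP; rewrite eqn_leq -{1}bk -{1}ak; apply/andP; split.
    by apply: col_mono; apply: ltnW; apply: sf jl _ _ fd fb.
  by apply: col_mono; apply: ltnW; apply: sf ij _ _ fa fd.
by rewrite !E.
Qed.

End Colour.

(** * The norming set *)
Section NormingSet.
Variables (R : realType) (m n s : nat -> nat).
Hypothesis Hparam : admissible_parameters m n s.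
Variable sigma : block_seq R -> nat.
Hypothesis Hsigma : coding_function m sigma.
Implicit Types (f g h u x : nat -> R) (phi : block_seq R).

Local Notation Klev := (Klev m n sigma).
Local Notation K := (K m n sigma).

Lemma m_ge2 p : (0 < p)%N -> (2 <= m p)%N.
Proof.
case: Hparam => m1 _ H; elim: p => // -[|p] IH _; first by rewrite m1.
have [_ -> _ _] := H p.+1 isT; apply: leq_trans (IH isT) _.
by rewrite -[leqLHS]expn1 leq_exp2l // IH.
Qed.

Lemma m_ge6 p : (2 <= p)%N -> (6 <= m p)%N.
Proof.
case: p => [//|p] p1; case: Hparam => m1 _ H.
have [_ -> _ _] := H p p1; apply: (@leq_trans (2 ^ 5)%N) => //.
by rewrite leq_exp2r // m_ge2.
Qed.

Lemma n_gt0 p : (0 < p)%N -> (0 < n p)%N.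
Proof. by case: Hparam => _ _ H /H[[]]. Qed.

(** Induction on the level at which a functional appears.  In the two steps
the hypothesis covers all the weights q, since the pieces of a functional of
weight p may have any weight. *)
Lemma Klev_ind (P : nat -> nat -> (nat -> R) -> Prop) :
  (forall r f, @K0 R f -> P r 0%N f) ->
  (forall r p f, Klev r p f -> P r p f -> P r.+1 p f) ->
  (forall r p f, (0 < p)%N -> ~~ odd p -> (forall q h, Klev r q h -> P r q h) ->
     even_step m n (Klev r) p f -> P r.+1 p f) ->
  (forall r p f, (2 < p)%N -> odd p -> (forall q h, Klev r q h -> P r q h) ->
     odd_step m n sigma (Klev r) p f -> P r.+1 p f) ->
  forall r p f, Klev r p f -> P r p f.
Proof.
move=> P0 PS Pe Po; elim=> [|r IH] p f; first by case: p => // /P0.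
case: p => [/P0 //|p] /= [Kf|]; first by apply: PS => //; apply: IH.
case: ifP => [ep|/negbT/negPn op]; first by apply: Pe.
by case: ifP => // p3; apply: Po.
Qed.

Lemma KlevS r p : Klev r p `<=` Klev r.+1 p.
Proof. by case: p => [|p] f Kf; [case: r Kf | left]. Qed.

Lemma Klev_even r p f : (0 < p)%N -> ~~ odd p ->
  even_step m n (Klev r) p f -> Klev r.+1 p f.
Proof. by case: p => // p _ op ef; right; rewrite op. Qed.

Lemma Klev_odd r p f : (2 < p)%N -> odd p ->
  odd_step m n sigma (Klev r) p f -> Klev r.+1 p f.
Proof. by case: p => // p p2 op ef; right; rewrite op p2. Qed.

Lemma Klev_opp r p f : Klev r p f -> Klev r p (- f).
Proof.
elim/Klev_ind: r p f / => [r f [k k0 kf]|r p f _|r p f p0 ep IH|r p f p2 op _].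
- have : @K0 R (- f) by exists k => //; case: kf => ->; [right|left]; rewrite ?opprK.
  by case: r.
- exact: KlevS.
- case=> d [h [d1 sh hK ->]]; apply: Klev_even => //.
  exists d, (fun i => - h i); split=> //.
  + by apply: successive_supp sh => i; rewrite supp_opp.
  + by move=> i; have [j _ hj] := hK i; exists j => //; apply: IH.
  + by rewrite sumrN scalerN.
- case=> phi [sp sz Lf [b [E [f' [lam [iE hf' ->]]]]]]; apply: Klev_odd => //.
  exists phi; split=> //; exists (~~ b), E, f', lam; split=> //.
  by rewrite -scaleNr; congr (_ *: _); rewrite -mulNr; case: (b); rewrite ?opprK.
Qed.

Lemma Klev_sign r p f (b : bool) : Klev r p f -> Klev r p ((-1) ^+ b *: f).
Proof.
by case: b => ?; rewrite ?expr0 ?expr1 ?scale1r // scaleN1r; apply: Klev_opp.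
Qed.

End NormingSet.

(** * Special sequences *)
Section Hulls.
Variable R : realType.
Implicit Types f g u x : nat -> R.

Lemma supp_hull x : supp x `<=` hull x.
Proof. exact: sub_gen_smallest. Qed.

Lemma supp_add_before f g : set_before (supp f) (supp g) ->
  supp (f + g) = supp f `|` supp g.
Proof.
move=> fg; apply/seteqP; split=> c; rewrite /supp /= fctE.
  move=> h; apply/orP; apply: contraNT h; rewrite negb_or !negbK.
  by case/andP=> /eqP -> /eqP ->; rewrite addr0.
case=> h.
  by rewrite (@eq0_notin_supp _ g c) ?addr0 // => /(fg c c h); rewrite ltnn.
by rewrite (@eq0_notin_supp _ f c) ?add0r // => h'; have := fg c c h' h; rewrite ltnn.
Qed.

Lemma supp_pair (a : R) f g h : a != 0 -> supp h = supp g ->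
  set_before (supp f) (supp g) -> supp (a *: f + h) = supp f `|` supp g.
Proof. by move=> a0 hg fg; rewrite supp_add_before supp_scale // hg. Qed.

Lemma norm_sum_successive N (h : 'I_N -> nat -> R) C c : 0 <= C ->
  successive h -> (forall i, `|h i c| <= C) -> `|(\sum_(i < N) h i) c| <= C.
Proof.
move=> C0 sh hC; have [[i hi]|h0] := pselect (exists i, supp (h i) c).
  by rewrite (sum_successive sh hi).
rewrite fct_sumE big1 ?normr0 // => i _; apply: eq0_notin_supp => hi; apply: h0.
by exists i.
Qed.

End Hulls.

Section SpecialSequences.
Variables (R : realType) (m n s : nat -> nat).
Hypothesis Hparam : admissible_parameters m n s.
Variable sigma : block_seq R -> nat.
Hypothesis Hsigma : coding_function m sigma.
Implicit Types (f g h u x : nat -> R) (phi : block_seq R).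

Local Notation Klev := (Klev m n sigma).

Lemma Qs_take phi l : Qs phi -> (0 < l <= size phi)%N -> Qs (take l phi).
Proof.
case=> [sz Qp bp] /andP[l0 ls].
have st : size (take l phi) = l by rewrite size_take_min; apply/minn_idPl.
have E i : (1 <= i <= l)%N -> nth (0, 0) (take l phi) i.-1 = nth (0, 0) phi i.-1.
  by move=> /andP[i1 il]; rewrite nth_take //; case: i i1 il.
split; rewrite ?st // => i /andP[i1 il].
  by rewrite /vec /func !E ?i1 //; apply: Qp; rewrite i1 (leq_trans il).
rewrite /joint_hull /vec /func !E ?i1 ?(ltnW il) //.
by apply: bp; rewrite i1 (leq_trans il).
Qed.

(** The order on consecutive terms extends to all terms because no support in a
special sequence is empty. *)
Lemma joint_hull_before phi i j : Qs phi -> (0 < i)%N -> (i < j <= size phi)%N ->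
  set_before (joint_hull phi i) (joint_hull phi j).
Proof.
case=> [_ Qp bp] i0; elim: j => // j IH /andP[]; rewrite ltnS leq_eqVlt.
move=> /orP[/eqP <-|ij] js; first by apply: bp; rewrite i0.
move=> a c ha hc; have [|[_ [b fb] _ _] _] := Qp j.
  by rewrite (leq_trans i0 (ltnW ij)) ltnW.
have jb : joint_hull phi j b by left; apply: supp_hull.
have ab : (a < b)%N by apply: IH ha jb; rewrite ij ltnW.
apply: ltn_trans ab _; apply: bp jb hc.
by rewrite (leq_trans i0 (ltnW ij)).
Qed.

Lemma func_before phi i j : Qs phi -> (0 < i)%N -> (i < j <= size phi)%N ->
  set_before (supp (func phi i)) (supp (func phi j)).
Proof.
by move=> Qp i0 ij a b ha hb; apply: joint_hull_before Qp i0 ij _ _ _ _;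
  right; apply: supp_hull.
Qed.

Lemma sigma_even phi : Qs phi -> (0 < sigma phi)%N /\ ~~ odd (sigma phi).
Proof.
by case: Hsigma => _ H /H[[j j0 ->] _ _]; rewrite double_gt0 j0 odd_double.
Qed.

Section Special.
Variables (k : nat) (phi : block_seq R).
Hypothesis sphi : special_sequence m n sigma k phi.

(** The weights of the odd terms are even: the first one by the choice of
m_(2j), the others because they are values of the coding function. *)
Lemma special_odd_average i : (i < k)%N -> exists p,
  [/\ (0 < p)%N, ~~ odd p & basis_average m n p (vec phi i.*2.+1) (func phi i.*2.+1)].
Proof.
case: sphi => [[k0 Qp sz] [[j [j0 _ hj]] _ h]]; case: i => [_|i ik].
  by exists j.*2; rewrite double_gt0 odd_double.
exists (sigma (take i.+1.*2 phi)); have [|p0 pe] := @sigma_even (take i.+1.*2 phi).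
  by apply: Qs_take => //; rewrite sz; lia.
by split=> //; apply: h.
Qed.

Lemma special_code_even i : (i < k)%N ->
  (0 < sigma (take i.*2.+1 phi))%N /\ ~~ odd (sigma (take i.*2.+1 phi)).
Proof.
case: sphi => [[k0 Qp sz] _] ik; apply/sigma_even/Qs_take => //.
by rewrite sz; lia.
Qed.

Lemma special_pair_before i : (i < k)%N ->
  set_before (supp (func phi i.*2.+1)) (supp (func phi i.*2.+2)).
Proof.
case: sphi => [[k0 Qp sz] _] ik; apply: func_before => //.
by rewrite sz; lia.
Qed.

Lemma special_pairs_successive (F : 'I_k -> nat -> R) :
  (forall i : 'I_k, supp (F i) =
     supp (func phi i.*2.+1) `|` supp (func phi i.*2.+2)) ->
  successive F.
Proof.
case: sphi => [[k0 Qp sz] _] FE i j ij a b; rewrite !FE.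
have := ltn_ord j; move=> jk.
by case=> ha [] hb; apply: func_before ha hb => //; rewrite sz; lia.
Qed.

Lemma special_norm_le1 i c : (0 < i <= k.*2)%N -> `|func phi i c| <= 1.
Proof.
by case: sphi => [[k0 Qp sz] _] ik; case: Qp => _ /(_ i); rewrite sz => /(_ ik)[_ []].
Qed.

Lemma special_vec_c00 i : (0 < i <= k.*2)%N -> c00 (vec phi i).
Proof.
by case: sphi => [[k0 Qp sz] _] ik; case: Qp => _ /(_ i); rewrite sz => /(_ ik)[[]].
Qed.

End Special.

(** The bound m_q^-1 on the values at x_(2i) is what keeps the coefficients
lambda in [-1, 1]; they do not vanish, so that the support of an odd
functional does not depend on them. *)
Lemma odd_coefficient p q f x (lam : R) : (0 < p)%N -> (0 < q)%N -> c00 x ->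
  `|pairing f x| <= (m q)%:R^-1 ->
  (if pairing f x != 0 then lam = pairing f ((m q)%:R *: x)
   else lam = ((n p)%:R ^+ 2)^-1 \/ lam = - ((n p)%:R ^+ 2)^-1) ->
  lam != 0 /\ `|lam| <= 1.
Proof.
move=> p0 q0 cx fx; have mq : 0 < (m q)%:R :> R.
  by rewrite ltr0n; apply: leq_trans (m_ge2 Hparam q0).
case: ifP => [nz ->|_].
  rewrite pairingZr //; split; first by apply: mulf_neq0 => //; rewrite gt_eqF.
  rewrite normrM gtr0_norm //.
  by rewrite -[leRHS](mulfV (lt0r_neq0 mq)) ler_wpM2l // ltW.
have np : 0 < (n p)%:R :> R by rewrite ltr0n (n_gt0 Hparam).
have [np1 np2] : ((n p)%:R ^+ 2)^-1 != 0 :> R /\ `|((n p)%:R ^+ 2)^-1| <= 1 :> R.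
  have np2 : 0 < (n p)%:R ^+ 2 :> R by rewrite exprn_gt0.
  rewrite invr_eq0 lt0r_neq0 // gtr0_norm ?invr_gt0 // invf_le1 //.
  by rewrite exprn_ege1 // ler1n (n_gt0 Hparam).
by case=> ->; rewrite ?normrN ?oppr_eq0.
Qed.

(** 6 = 2 * 3 is the number of pieces that can err times the largest error of
one of them; weights of index at least 2 are at least 2^5. *)
Lemma invm_absorbs6 p C : (2 <= p)%N -> 0 <= C -> (m p)%:R^-1 * (6 * C) <= C :> R.
Proof.
move=> p2 C0; have m6 : (6 : R) <= (m p)%:R by rewrite ler_nat (m_ge6 Hparam).
rewrite mulrC ler_pdivrMr; last by apply: lt_le_trans m6.
by rewrite mulrC ler_wpM2l.
Qed.

(** The pieces of a functional have disjoint supports, and on each of them the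
coordinates are at most 1 or, for the pairs of an odd functional, at most 2. *)
Lemma Klev_norm_le1 r p f c : Klev r p f -> `|f c| <= 1.
Proof.
move=> Kf; elim/(Klev_ind (m := m) (n := n) (sigma := sigma)): r p f / Kf
  => [r f [k _ kf]|//|r p f p0 ep IH|r p f p2 op IH].
- case: kf => ->; rewrite ?fctE ?normrN /basis_vec; case: eqP;
  by rewrite ?normr1 ?normr0.
- case=> d [h [/andP[d1 dn] sh hK ->]].
  have p2 : (2 <= p)%N by case: p p0 ep {dn} => [|[]].
  rewrite fctE /= [_ *: _]/(_ * _) normrM ger0_norm ?invr_ge0 ?ler0n //.
  apply: le_trans (invm_absorbs6 p2 ler01); apply: ler_wpM2l; first by rewrite invr_ge0.
  apply: norm_sum_successive => // i.
  by have [j _ /IH hj] := hK i; apply: le_trans hj _; rewrite mulr1 ler1n.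
- case=> phi [sp sz Lf [b [E [f' [lam [iE hf' ->]]]]]].
  rewrite big_add1 big_mkord /= fctE [_ *: _]/(_ * _) !normrM normr_sign mul1r.
  rewrite ger0_norm ?invr_ge0 ?ler0n //.
  apply: le_trans (invm_absorbs6 (ltnW p2) ler01).
  apply: ler_wpM2l; first by rewrite invr_ge0.
  rewrite patchE; case: ifP => _; last by rewrite normr0 mulr1.
  have hp (i : 'I_((n p)./2)) : lam i.+1 != 0 /\ `|lam i.+1| <= 1.
    have [|L1 L2 L3 L4] := hf' i.+1; first by rewrite ltn_ord.
    have [q0 _] := special_code_even sp (ltn_ord i).
    apply: odd_coefficient q0 _ (L3 _ L1) L4; first exact: ltnW (ltnW p2).
    by apply: (special_vec_c00 sp); have := ltn_ord i; lia.
  apply: norm_sum_successive => //.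
    apply: (special_pairs_successive sp) => i.
    have [|_ sf _ _] := hf' i.+1; first by rewrite ltn_ord.
    exact: (supp_pair (hp i).1 sf (special_pair_before sp (ltn_ord i))).
  move=> i; have [|L1 _ _ _] := hf' i.+1; first by rewrite ltn_ord.
  rewrite !fctE; apply: le_trans (ler_normD _ _) _.
  rewrite [_ *: _]/(_ * _) normrM; have [_ l1] := hp i.
  have F1 : `|func phi i.+1.*2.-1 c| <= 1.
    by apply: (special_norm_le1 sp c); have := ltn_ord i; lia.
  have : `|lam i.+1| * `|func phi i.+1.*2.-1 c| <= 1 by rewrite mulr_ile1.
  have := IH _ _ L1; lra.
Qed.

End SpecialSequences.

(** * The norm and the averages *)
Section Norm.
Variables (R : realType) (m n s : nat -> nat).
Hypothesis Hparam : admissible_parameters m n s.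
Variable sigma : block_seq R -> nat.
Hypothesis Hsigma : coding_function m sigma.
Implicit Types (f g h u x : nat -> R) (phi : block_seq R).

Local Notation Klev := (Klev m n sigma).
Local Notation K := (K m n sigma).
Local Notation normK := (normK m n sigma).

Lemma supp_basis k : supp (basis_vec R k) = [set k].
Proof.
apply/seteqP; split=> c; rewrite /supp /basis_vec /= pnatr_eq0 eqb0 negbK.
  by move/eqP.
by move=> ->.
Qed.

Lemma Klev_K r p f : Klev r p f -> K f.
Proof. by move=> Kf; exists r => //; exists p. Qed.

Lemma K_opp f : K f -> K (- f).
Proof. by case=> r _ [p _ /(Klev_opp)]; apply: Klev_K. Qed.

Lemma K_norm_le1 f c : K f -> `|f c| <= 1.
Proof. by case=> r _ [p _ Kf]; apply: (Klev_norm_le1 Hparam Hsigma c Kf). Qed.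

Lemma K_basis c : (0 < c)%N -> K (basis_vec R c).
Proof. by move=> c0; apply: (@Klev_K 0 0); exists c => //; left. Qed.

Lemma norm_pairing_le N f x : K f -> (forall c, (N <= c)%N -> x c = 0) ->
  `|pairing f x| <= \sum_(c < N) `|x c|.
Proof.
move=> Kf xN; rewrite (pairing_ord _ xN); apply: le_trans (ler_norm_sum _ _ _) _.
apply: ler_sum => c _; rewrite normrM -[leRHS]mul1r ler_wpM2r //.
exact: K_norm_le1.
Qed.

Lemma normK_has_sup x : c00 x -> has_sup [set pairing f x | f in K].
Proof.
move=> /c00_eventually0[N xN]; split.
  by exists (pairing (basis_vec R 1) x), (basis_vec R 1) => //; apply: K_basis.
exists (\sum_(c < N) `|x c|) => _ [f Kf <-].
by apply: le_trans (norm_pairing_le Kf xN); apply: ler_norm.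
Qed.

Lemma pairing_le_normK f x : c00 x -> K f -> `|pairing f x| <= normK x.
Proof.
move=> cx; have [_ hb] := normK_has_sup cx => Kf.
have ub g : K g -> pairing g x <= normK x.
  by move=> Kg; apply: sup_upper_bound; [exact: normK_has_sup|exists g].
rewrite ler_norml ub // andbT lerNl -pairingN //; exact/ub/K_opp.
Qed.

Lemma normK_le x C : c00 x -> (forall f, K f -> pairing f x <= C) -> normK x <= C.
Proof.
move=> cx h; apply: ge_sup => [|_ [f Kf <-]]; last exact: h.
by have [] := normK_has_sup cx.
Qed.

Lemma normK_le_sum N x : x 0%N = 0 -> (forall c, (N <= c)%N -> x c = 0) ->
  normK x <= \sum_(c < N) `|x c|.
Proof.
move=> x0 xN; apply: normK_le => [|f Kf]; first exact: c00_of_tail xN.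
by apply: le_trans (norm_pairing_le Kf xN); apply: ler_norm.
Qed.

Lemma coord_le_normK x c : c00 x -> `|x c| <= normK x.
Proof.
move=> cx; case: c => [|c]; last first.
  by rewrite -(pairing_basis c.+1 cx); apply: pairing_le_normK => //; apply: K_basis.
rewrite cx.1 normr0; apply: le_trans (pairing_le_normK cx (@K_basis 1 _)) => //.
Qed.

(** The value at |x| of the functional which an odd term of a special sequence
has for the weight p. *)
Definition average p (t : 'I_(n p) -> nat) x : R :=
  (m p)%:R^-1 * \sum_(l < n p) `|x (t l)|.

Definition small_averages x d := forall p (t : 'I_(n p) -> nat),
  (0 < p)%N -> ~~ odd p -> injective t -> (forall l, (0 < t l)%N) ->
  average t x <= d.

Lemma average_ge0 p (t : 'I_(n p) -> nat) x : 0 <= average t x.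
Proof. by rewrite mulr_ge0 ?invr_ge0 ?sumr_ge0. Qed.

Lemma small_averages_ge0 x d : small_averages x d -> 0 <= d.
Proof.
(* There is at least one average, with weight 2 and t l = l + 1. *)
move=> /(_ 2%N (fun l => l.+1) isT isT) sx.
apply: le_trans (average_ge0 _ _) (sx _ _) => //.
by move=> a b [/val_inj].
Qed.

Lemma small_averages_mono x y d : (forall c, `|y c| <= `|x c|) ->
  small_averages x d -> small_averages y d.
Proof.
move=> yx sx p t p0 ep it t0; apply: le_trans (sx p t p0 ep it t0).
by rewrite ler_wpM2l ?invr_ge0 //; apply: ler_sum.
Qed.

Lemma restrict_le E x c : `|(x \_ E) c| <= `|x c|.
Proof. by rewrite patchE; case: ifP => // _; rewrite normr0. Qed.

(** The even steps need successive terms, so the coordinates t l are first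
sorted; the signs are those of x. *)
Lemma average_le_normK p (t : 'I_(n p) -> nat) x : c00 x ->
  (0 < p)%N -> ~~ odd p -> injective t -> (forall l, (0 < t l)%N) ->
  average t x <= normK x.
Proof.
move=> cx p0 ep it t0; pose r := sort leq (codom t).
have szr : size r = n p by rewrite size_sort size_codom card_ord.
have ur : uniq r by rewrite sort_uniq; apply/injectiveP.
pose h (i : 'I_(n p)) : nat -> R :=
  if x (nth 0%N r i) < 0 then - basis_vec R (nth 0%N r i)
  else basis_vec R (nth 0%N r i).
have hs i : supp (h i) = [set nth 0%N r i].
  by rewrite /h; case: ifP => _; rewrite ?supp_opp supp_basis.
have hx i : pairing (h i) x = `|x (nth 0%N r i)|.
  rewrite /h; case: ltP => xi; rewrite ?pairingN // pairing_basis //.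
    by rewrite ltr0_norm.
  by rewrite ger0_norm.
have Kh : K ((m p)%:R^-1 *: \sum_(i < n p) h i).
  apply: (@Klev_K 1 p); apply: Klev_even => //; exists (n p), h; split=> //.
  - by rewrite leqnn (n_gt0 Hparam).
  - move=> i j ij a b; rewrite !hs => -> ->.
    rewrite ltn_neqAle nth_uniq ?szr // neq_ltn ij /=.
    apply: (sorted_leq_nth leq_trans leqnn) => //; rewrite ?inE ?szr //.
      exact: sort_sorted leq_total _.
    exact: ltnW.
  - move=> i; exists 0%N => //; exists (nth 0%N r i).
      have : nth 0%N r i \in r by rewrite mem_nth ?szr.
      by rewrite mem_sort => /codomP[l ->].
    by rewrite /h; case: ifP; [right|left].
have := pairing_le_normK cx Kh; apply: le_trans; apply: le_trans (ler_norm _).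
rewrite pairingZ // pairing_sum // /average ler_wpM2l ?invr_ge0 //.
rewrite [leRHS](_ : _ = \sum_(c <- r) `|x c|); last first.
  rewrite (big_nth 0%N) big_mkord szr; apply: eq_bigr => i _; exact: hx.
by rewrite (perm_big _ (permEl (perm_sort _ _))) /= /codom big_image.
Qed.

(** * Changing signs in the norming set *)
Section SignChange.
Variables (col : nat -> nat) (eps : nat -> bool).
Hypothesis col_mono : {homo col : a b / (a <= b)%N}.

Definition approx_sign f g := forall k u d, c00 u -> coloured col k u ->
  small_averages u d -> `|pairing g u - (-1) ^+ eps k * pairing f u| <= d.

Definition exact_sign f g := forall k u, c00 u -> coloured col k u ->
  pairing g u = (-1) ^+ eps k * pairing f u.

Lemma exact_approx f g : exact_sign f g -> approx_sign f g.
Proof.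
move=> e k u d cu uk /small_averages_ge0 d0.
by rewrite (e k) // subrr normr0.
Qed.

Lemma supp_signZ (b : bool) f : supp ((-1) ^+ b *: f) = supp f.
Proof. by rewrite supp_scale // signr_eq0. Qed.

Lemma monochromatic_exact r p f : Klev r p f -> monochromatic col (supp f) ->
  exists g, [/\ Klev r p g, supp g = supp f & exact_sign f g].
Proof.
move=> Kf /(monochromatic_sign R eps)[b hb]; exists ((-1) ^+ b *: f); split.
- exact: Klev_sign.
- exact: supp_signZ.
- by move=> k u; apply: hb.
Qed.

(** For a functional which meets one colour, a change of sign beats whatever the
induction provides. *)
Lemma approx_sign_strengthen r p f : Klev r p f ->
  (exists g, [/\ Klev r p g, supp g = supp f & approx_sign f g]) ->
  exists g, [/\ Klev r p g, supp g = supp f, approx_sign f g &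
    monochromatic col (supp f) -> exact_sign f g].
Proof.
move=> Kf [g [Kg gf ag]]; have [/(monochromatic_exact Kf)[h [Kh hf eh]]|nm] :=
  pselect (monochromatic col (supp f)); last by exists g; split.
by exists h; split=> //; apply: exact_approx.
Qed.

Lemma coloured_restrict k u E : coloured col k u -> coloured col k (u \_ E).
Proof. by move=> uk c; rewrite patchE; case: ifP; [move=> _; apply: uk|rewrite eqxx]. Qed.

Lemma basis_average_pairing p x f u d : (0 < p)%N -> ~~ odd p ->
  basis_average m n p x f -> c00 u -> small_averages u d -> `|pairing f u| <= d.
Proof.
move=> p0 ep [t [it t0 _ ->]] cu su; apply: le_trans (su p t p0 ep it t0).
rewrite pairingZ // pairing_sum // normrM ger0_norm ?invr_ge0 //.
rewrite ler_wpM2l ?invr_ge0 //; apply: le_trans (ler_norm_sum _ _ _) _.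
by apply: ler_sum => l _; rewrite pairing_basis.
Qed.

(** The factor 2 of pairing_pieces is absorbed by the weight. *)
Lemma sign_even r p f : (0 < p)%N -> ~~ odd p ->
  (forall q h, Klev r q h ->
     exists g, [/\ Klev r q g, supp g = supp h & approx_sign h g]) ->
  even_step m n (Klev r) p f ->
  exists g, [/\ Klev r.+1 p g, supp g = supp f & approx_sign f g].
Proof.
move=> p0 ep IH [d [h [d1 sh hK ->]]].
have p2 : (2 <= p)%N by case: p p0 ep {d1} => [|[]].
have mp0 : (m p)%:R^-1 != 0 :> R.
  by rewrite invr_eq0 pnatr_eq0 -lt0n; apply: leq_trans (m_ge2 Hparam p0).
have /choice[g hg] : forall i, exists g, [/\ (\bigcup_j Klev r j) g,
    supp g = supp (h i), approx_sign (h i) g &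
    monochromatic col (supp (h i)) -> exact_sign (h i) g].
  move=> i; have [j _ hj] := hK i.
  have [g [gj gs ga ge]] := approx_sign_strengthen hj (IH _ _ hj).
  by exists g; split=> //; exists j.
have gs i : supp (g i) = supp (h i) by case: (hg i).
exists ((m p)%:R^-1 *: \sum_(i < d) g i); split.
- apply: Klev_even => //; exists d, g; split=> //.
    exact: successive_supp gs sh.
  by move=> i; case: (hg i).
- rewrite !supp_scale // !supp_sum_successive //; last exact: successive_supp gs sh.
  exact: eq_bigcupr.
- move=> k u e cu uk su; have e0 := small_averages_ge0 su.
  rewrite !pairingZ // mulrCA -mulrBr normrM ger0_norm ?invr_ge0 //.
  apply: le_trans (invm_absorbs6 Hparam p2 e0); rewrite ler_wpM2l ?invr_ge0 //.
  apply: le_trans (_ : 2 * e <= _); last by lra.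
  apply: (pairing_pieces col_mono e0 cu uk sh gs) => i.
    by case: (hg i) => _ _ + _; apply.
  by case: (hg i) => _ _ _ + hm => /(_ hm); apply.
Qed.

(** The pieces are the pairs lambda f_(2i-1) + f'_(2i).  If a pair is
monochromatic its sign is changed as a whole.  If it is not, f'_(2i) is
replaced by the g given by induction and lambda by the coefficient mu that g
imposes; as |mu|, |lambda| <= 1, the error is at most 2 |f_(2i-1)(u)| plus the
error of g, hence at most three times the bound on the averages of u. *)
Lemma sign_odd r p f : (2 < p)%N -> odd p ->
  (forall q h, Klev r q h ->
     exists g, [/\ Klev r q g, supp g = supp h & approx_sign h g]) ->
  odd_step m n sigma (Klev r) p f ->
  exists g, [/\ Klev r.+1 p g, supp g = supp f & approx_sign f g].
Proof.
move=> p2 op IH [phi [sp sz Lf [b [E [f' [lam [iE hf' ->]]]]]]].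
pose code i := sigma (take i.*2.-1 phi).
(* The pairs (f'_(2i), lambda) which the odd step allows at i. *)
pose valid (i : nat) (v : (nat -> R) * R) := [/\ Klev r (code i) v.1,
  supp v.1 = supp (func phi i.*2) &
  if pairing v.1 (vec phi i.*2) != 0
  then v.2 = pairing v.1 ((m (code i))%:R *: vec phi i.*2)
  else v.2 = ((n p)%:R ^+ 2)^-1 \/ v.2 = - ((n p)%:R ^+ 2)^-1].
pose piece (i : nat) (v : (nat -> R) * R) : nat -> R := v.2 *: func phi i.*2.-1 + v.1.
have p0 : (0 < p)%N by rewrite (ltn_trans _ p2).
have mp0 : (m p)%:R^-1 != 0 :> R.
  by rewrite invr_eq0 pnatr_eq0 -lt0n; apply: leq_trans (m_ge2 Hparam p0).
have vf (i : 'I_((n p)./2)) : valid i.+1 (f' i.+1, lam i.+1).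
  by have [|? ? ? ?] := hf' i.+1; [rewrite ltn_ord|split].
have bnd (i : 'I_((n p)./2)) g : Klev r (code i.+1) g ->
    `|pairing g (vec phi i.+1.*2)| <= (m (code i.+1))%:R^-1.
  by have [|_ _ h _] := hf' i.+1; [rewrite ltn_ord|exact: h].
have cvec (i : 'I_((n p)./2)) : c00 (vec phi i.+1.*2).
  by apply: (special_vec_c00 sp); have := ltn_ord i; lia.
have coef (i : 'I_((n p)./2)) v : valid i.+1 v -> v.2 != 0 /\ `|v.2| <= 1.
  case=> v1 v2 v3; have [q0 _] := special_code_even Hsigma sp (ltn_ord i).
  exact: (odd_coefficient Hparam p0 q0 (cvec i) (bnd i _ v1) v3).
have psupp (i : 'I_((n p)./2)) v : valid i.+1 v ->
    supp (piece i.+1 v) = supp (func phi i.*2.+1) `|` supp (func phi i.*2.+2).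
  move=> vv; have [v0 _] := coef i v vv; case: vv => _ v2 _.
  exact: (supp_pair v0 v2 (special_pair_before sp (ltn_ord i))).
have /choice[v hv] : forall i : 'I_((n p)./2), exists v, [/\ valid i.+1 v,
    monochromatic col (supp (piece i.+1 (f' i.+1, lam i.+1))) ->
      exact_sign (piece i.+1 (f' i.+1, lam i.+1)) (piece i.+1 v) &
    forall k u d, c00 u -> coloured col k u -> small_averages u d ->
     `|pairing (piece i.+1 v) u -
       (-1) ^+ eps k * pairing (piece i.+1 (f' i.+1, lam i.+1)) u| <= 3 * d].
  move=> i; have [v1 v2 v3] := vf i; rewrite /= in v1 v2 v3.
  have [mono|nm] := pselect (monochromatic col (supp (piece i.+1 (f' i.+1, lam i.+1)))).
    have [c hc] := monochromatic_sign R eps mono.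
    have ex : exact_sign (piece i.+1 (f' i.+1, lam i.+1))
        (piece i.+1 ((-1) ^+ c *: f' i.+1, (-1) ^+ c * lam i.+1)).
      move=> k u cu uk; rewrite -(hc _ k u _ cu uk) //.
      by congr pairing; rewrite /piece /= scalerDr scalerA.
    exists ((-1) ^+ c *: f' i.+1, (-1) ^+ c * lam i.+1); split=> //.
      split; rewrite /= ?supp_signZ //; first exact: Klev_sign.
      move: v3; rewrite (pairingZ (cvec i)) (pairingZ (c00_Z _ (cvec i))) mulf_eq0 signr_eq0 /=.
      case: ifP => _ => [->//|].
      by case: (c) => /=; rewrite ?expr0 ?expr1 ?mul1r ?mulN1r //;
         case=> ->; rewrite ?opprK; [right|left].
    move=> k u d cu uk su; have d0 := small_averages_ge0 su.
    by rewrite (ex k) // subrr normr0 mulr_ge0.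
  have [g [Kg gf ag]] := IH _ _ v1.
  pose mu := if pairing g (vec phi i.+1.*2) != 0
    then pairing g ((m (code i.+1))%:R *: vec phi i.+1.*2)
    else ((n p)%:R ^+ 2)^-1.
  have vg : valid i.+1 (g, mu).
    split=> //=; first by rewrite gf.
    by rewrite /mu; case: ifP => E0; rewrite E0 //; left.
  exists (g, mu); split=> // k u d cu uk su.
  have [q [q0 eq ha]] := special_odd_average Hsigma sp (ltn_ord i).
  have F := basis_average_pairing q0 eq ha cu su.
  have [_ m1] := coef i _ vg; have [_ l1] := coef i _ (vf i); rewrite /= in m1 l1.
  rewrite /piece /= !pairingD // !pairingZ //.
  rewrite [X in `|X|](_ : _ = (mu - (-1) ^+ eps k * lam i.+1) *
     pairing (func phi i.*2.+1) u +
     (pairing g u - (-1) ^+ eps k * pairing (f' i.+1) u)); last by ring.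
  apply: le_trans (ler_normD _ _) _.
  rewrite (_ : 3 * d = 2 * d + d); last by ring.
  apply: lerD; last exact: ag.
  rewrite normrM ler_pM //; apply: le_trans (ler_normB _ _) _.
  by rewrite normrM normr_sign mul1r; lra.
have sf := special_pairs_successive sp (fun i => psupp i _ (vf i)).
have sv (i : 'I_((n p)./2)) : supp (piece i.+1 (v i)) = supp (piece i.+1 (f' i.+1, lam i.+1)).
  by rewrite !psupp //; case: (hv i).
(* g' and mu are only evaluated at 1, .., n_p / 2; the value 0 elsewhere is
   immaterial. *)
pose g' (i : nat) := oapp (fun j => (v j).1) 0 (insub i.-1 : option 'I_((n p)./2)).
pose mu (i : nat) := oapp (fun j => (v j).2) 0 (insub i.-1 : option 'I_((n p)./2)).
have gE (i : 'I_((n p)./2)) : g' i.+1 = (v i).1 by rewrite /g' /= valK.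
have mE (i : 'I_((n p)./2)) : mu i.+1 = (v i).2 by rewrite /mu /= valK.
exists (((-1) ^+ b / (m p)%:R) *:
  ((\sum_(i < (n p)./2) piece i.+1 (v i)) \_ E)).
rewrite big_add1 big_mkord /=.
have s0 : (-1) ^+ b / (m p)%:R != 0 :> R by rewrite mulf_neq0 // signr_eq0.
split.
- apply: Klev_odd => //; exists phi; split=> //; exists b, E, g', mu; split=> //.
    move=> [//|i] /= iN; have [[h1 h2 h3] _ _] := hv (Ordinal iN).
    rewrite (gE (Ordinal iN)) (mE (Ordinal iN)); split=> //.
    by have [|_ _ h _] := hf' i.+1.
  rewrite big_add1 big_mkord /=; congr (_ *: (_ \_ _)).
  by apply: eq_bigr => i _; rewrite gE mE.
- rewrite !supp_scale //; apply: supp_restrict_eq.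
  rewrite supp_sum_successive; last exact: successive_supp sv sf.
  rewrite supp_sum_successive; last exact: sf.
  by apply: eq_bigcupr => i _; exact: sv.
- move=> k u d cu uk su; have d0 := small_averages_ge0 su.
  rewrite !pairingZ // !pairing_restrict mulrCA -mulrBr !normrM normr_sign mul1r.
  rewrite ger0_norm ?invr_ge0 //.
  apply: le_trans (invm_absorbs6 Hparam (ltnW p2) d0); rewrite ler_wpM2l ?invr_ge0 //.
  have uE := coloured_restrict (E := E) uk.
  have sE := small_averages_mono (restrict_le E u) su.
  have cE := c00_restrict E cu.
  apply: le_trans (_ : 2 * (3 * d) <= _); last by lra.
  apply: (pairing_pieces col_mono (mulr_ge0 _ d0) cE uE sf sv) => [//|i|i hm].
    by case: (hv i) => _ _; apply.
  by case: (hv i) => _ + _ => /(_ hm); apply.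
Qed.

Theorem sign_change r p f : Klev r p f ->
  exists g, [/\ Klev r p g, supp g = supp f & approx_sign f g].
Proof.
move=> Kf; elim/(Klev_ind (m := m) (n := n) (sigma := sigma)): r p f / Kf
  => [r f Kf|r p f Kf [g [Kg gf ag]]|r p f|r p f].
- have Kf' : Klev r 0 f by case: r.
  have [|g [Kg gf eg]] := monochromatic_exact Kf'; last first.
    by exists g; split=> //; apply: exact_approx.
  have fs : exists k, supp f `<=` [set k].
    by case: Kf => k _ kf; exists k; case: kf => ->; rewrite ?supp_opp supp_basis.
  by have [k fk] := fs; move=> a c /fk -> /fk ->.
- by exists g; split=> //; apply: KlevS.
- exact: sign_even.
- exact: sign_odd.
Qed.

Lemma sign_change_K f : K f -> exists2 g, K g & approx_sign f g.
Proof.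
by case=> r _ [p _ /sign_change[g [Kg _ ag]]]; exists g => //; apply: Klev_K Kg.
Qed.

End SignChange.
End Norm.

(** * A criterion for unconditional basic sequences *)

(** In the applications, f t is the coordinate of a vector in a dense subspace
and r t a multiple of its distance to a limit z: this extends coordinate
functionals to the closure without choosing sequences. *)
Lemma approximable_value (R : realType) (T : Type) (t0 : T) (f r : T -> R) :
  (forall s t, f s - f t <= r s + r t) ->
  exists a, forall t, `|f t - a| <= r t.
Proof.
move=> h; pose A := [set f t - r t | t in [set: T]].
have A0 : A !=set0 by exists (f t0 - r t0), t0.
have ubA t : ubound A (f t + r t) by move=> _ [u _ <-]; have := h u t; lra.
have sA : has_sup A by split=> //; exists (f t0 + r t0).
exists (sup A) => t; rewrite ler_norml.
have := ge_sup A0 (ubA t).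
have : f t - r t <= sup A by apply: (sup_upper_bound sA); exists t.
move=> ? ?; apply/andP; split; lra.
Qed.

Section UnconditionalBasic.
Variables (R : realType) (X : normedModType R) (y : nat -> X) (C : R).
Hypothesis C0 : 0 <= C.
Hypothesis y1 : forall i, `|y i| = 1.

Definition partial_sum (a : nat -> R) d : X := \sum_(0 <= i < d) a i *: y i.
Local Notation S := partial_sum.

Hypothesis signs : forall d (a : nat -> R) (e : nat -> bool),
  `|S (fun i => (-1) ^+ e i * a i) d| <= C * `|S a d|.

Lemma partial_sumB a b d : S (a - b) d = S a d - S b d.
Proof.
by rewrite /S -sumrB; apply: eq_bigr => i _; rewrite -scalerBl.
Qed.

Lemma partial_sum_stable a d e : (forall i, (d <= i)%N -> a i = 0) ->
  (d <= e)%N -> S a e = S a d.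
Proof.
move=> a0 de; rewrite /S (big_cat_nat (leq0n d) de) //= [X in _ + X]big_nat.
rewrite [X in _ + X]big1 ?addr0 // => i /andP[di _].
by rewrite a0 // scale0r.
Qed.

Let D := (1 + C) / 2.

Let D0 : 0 <= D. Proof. by rewrite divr_ge0 // addr_ge0. Qed.

(** The sum over A is the mean of the full sum and of the sum in which the signs
outside A are changed. *)
Lemma subset_sum_le (A : pred nat) a d :
  `|\sum_(0 <= i < d | A i) a i *: y i| <= D * `|S a d|.
Proof.
have -> : \sum_(0 <= i < d | A i) a i *: y i =
    2^-1 *: (S a d + S (fun i => (-1) ^+ (~~ A i) * a i) d).
  rewrite /S -big_split /= scaler_sumr big_mkcond; apply: eq_bigr => i _ /=.
  rewrite -scalerDl scalerA; case: (A i); rewrite /= ?expr0 ?expr1.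
    by congr (_ *: _); field.
  by rewrite mulN1r subrr mulr0 scale0r.
rewrite normrZ ger0_norm ?invr_ge0 // /D mulrAC [leLHS]mulrC.
rewrite ler_wpM2r ?invr_ge0 //; apply: le_trans (ler_normD _ _) _.
by rewrite mulrDl mul1r lerD2l.
Qed.

Lemma partial_sum_le a d e : (d <= e)%N -> `|S a d| <= D * `|S a e|.
Proof.
move=> de; apply: le_trans (subset_sum_le (fun i => (i < d)%N) a e).
by rewrite /S (big_nat_widen _ _ e).
Qed.

Lemma coefficient_le a d i : (i < d)%N -> `|a i| <= D * `|S a d|.
Proof.
move=> id; apply: le_trans (subset_sum_le (fun j => j == i) a d).
by rewrite big_nat1_eq id normrZ y1 mulr1.
Qed.

(** Requiring the coefficients to vanish beyond the length makes partial sums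
of different lengths comparable. *)
Definition finite_expansion (p : (nat -> R) * nat) :=
  forall i, (p.2 <= i)%N -> p.1 i = 0.

Lemma linear_span_finite z : linear_span y z ->
  exists2 p, finite_expansion p & z = S p.1 p.2.
Proof.
case=> d [a ->]; exists (fun i => if (i < d)%N then a i else 0, d) => /=.
  by move=> i /=; rewrite leqNgt => /negPf ->.
rewrite /S big_mkord; apply: eq_bigr => i _; by rewrite ltn_ord.
Qed.

Lemma finite_expansions_le p q e : finite_expansion p -> finite_expansion q ->
  `|S (p.1 - q.1) e| <= D * `|S p.1 p.2 - S q.1 q.2|.
Proof.
move=> hp hq; have [M1 [M2 M3]] :
    (p.2 <= maxn e (maxn p.2 q.2))%N /\ (q.2 <= maxn e (maxn p.2 q.2))%N /\
    (e <= maxn e (maxn p.2 q.2))%N by lia.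
apply: le_trans (partial_sum_le _ M3) _.
by rewrite partial_sumB (partial_sum_stable hp M1) (partial_sum_stable hq M2).
Qed.

(** The coefficients of z are the limits of those of its finite approximations
p, and the partial sums of the limit coefficients minus p stay within
D * |z - S p| for every length. *)
Lemma expansion_exists z : closure (linear_span y) z ->
  exists a, expansion a y @ \oo --> z.
Proof.
move=> cz; have near e : 0 < e ->
    exists2 p, finite_expansion p & `|z - S p.1 p.2| < e.
  move=> e0; have [|w [/linear_span_finite[p hp ->] pz]] := cz (ball z e).
    exact: nbhsx_ballx.
  by exists p => //; move: pz; rewrite -ball_normE.
pose T := {p : (nat -> R) * nat | `[< finite_expansion p >]}.
have hT (t : T) : finite_expansion (sval t) by apply/asboolP; exact: (svalP t).
have t0 : T by exists (0, 0%N); apply/asboolP.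
have coef i : exists a, forall t : T,
    `|(sval t).1 i - a| <= D * `|z - S (sval t).1 (sval t).2|.
  apply: approximable_value => // p q; apply: le_trans (ler_norm _) _.
  have [M1 [M2 M3]] : ((sval p).2 <= maxn i.+1 (maxn (sval p).2 (sval q).2))%N /\
    ((sval q).2 <= maxn i.+1 (maxn (sval p).2 (sval q).2))%N /\
    (i < maxn i.+1 (maxn (sval p).2 (sval q).2))%N by lia.
  apply: le_trans (coefficient_le ((sval p).1 - (sval q).1) M3) _.
  rewrite partial_sumB (partial_sum_stable (hT p) M1) (partial_sum_stable (hT q) M2).
  rewrite -mulrDr ler_wpM2l //; apply: le_trans (ler_distD z _ _) _.
  by rewrite distrC.
have [a ha] := choice coef; exists a.
have main e p : finite_expansion p ->
    `|S (a - p.1) e| <= D * `|z - S p.1 p.2|.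
  move=> hp; apply/ler_addgt0Pr => eta eta0.
  (* The coefficients of a and of q differ by at most D * |z - S q|, and there
     are e of them: q is taken so close to z that this is negligible. *)
  pose c := e%:R * D + D + 1; have c0 : 0 < c.
    by rewrite ltr_wpDl // addr_ge0 // mulr_ge0.
  have [q hq qz] := near (eta / c) (divr_gt0 eta0 c0).
  have fq : `[< finite_expansion q >] by apply/asboolP.
  have -> : S (a - p.1) e = S (a - q.1) e + S (q.1 - p.1) e.
    by rewrite !partial_sumB addrA subrK.
  apply: le_trans (ler_normD _ _) _.
  have h1 : `|S (a - q.1) e| <= e%:R * (D * `|z - S q.1 q.2|).
    apply: le_trans (ler_norm_sum _ _ _) _.
    rewrite mulr_natl -[X in _ *+ X](subn0 e) -sumr_const_nat.
    apply: ler_sum => i _.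
    by rewrite normrZ y1 mulr1 distrC; apply: (ha i (exist _ q fq)).
  have h2 : `|S (q.1 - p.1) e| <= D * (`|z - S q.1 q.2| + `|z - S p.1 p.2|).
    apply: le_trans (finite_expansions_le e hq hp) _; rewrite ler_wpM2l //.
    by apply: le_trans (ler_distD z _ _) _; rewrite distrC.
  have h3 : (e%:R * D + D) * `|z - S q.1 q.2| <= eta.
    have: c * `|z - S q.1 q.2| <= eta by rewrite mulrC -ler_pdivlMr // ltW.
    apply: le_trans; rewrite ler_wpM2r // /c; lra.
  nra.
apply/cvgrPdist_lt => e e0.
have D1 : 0 < D + 1 by rewrite ltr_wpDl.
have [p hp pz] := near (e / (D + 1)) (divr_gt0 e0 D1).
near=> N; rewrite -/(S a N).
have pN : (p.2 <= N)%N by near: N; exact: nbhs_infty_ge.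
have : `|S (a - p.1) N| <= D * `|z - S p.1 p.2| by exact: main.
rewrite partial_sumB (partial_sum_stable hp pN) => h.
apply: le_lt_trans (ler_distD (S p.1 p.2) _ _) _.
rewrite [X in _ + X]distrC.
have : (D + 1) * `|z - S p.1 p.2| < e by rewrite mulrC -ltr_pdivlMr.
lra.
Unshelve. all: by end_near. Qed.

Lemma expansion_unique (z : X) a b : expansion a y @ \oo --> z ->
  expansion b y @ \oo --> z -> a = b.
Proof.
move=> az bz; have ab : (expansion a y - expansion b y) k @[k --> \oo] --> (0 : X).
  by rewrite -(subrr z); exact: cvgB.
apply/funext => i; apply/eqP; rewrite -subr_eq0 -normr_le0.
apply/ler_addgt0Pr => e e0; rewrite add0r.
have D1 : 0 < D + 1 by rewrite ltr_wpDl.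
have [N _ hN] := (iffLR (cvgrPdist_lt _ _) ab) _ (divr_gt0 e0 D1).
have /hN : (N <= maxn N i.+1)%N by lia.
rewrite /= sub0r normrN => h.
have : `|(a - b) i| <= D * `|S (a - b) (maxn N i.+1)| by apply: coefficient_le; lia.
rewrite partial_sumB => /le_trans; apply.
have : (D + 1) * `|S a (maxn N i.+1) - S b (maxn N i.+1)| < e.
  by rewrite mulrC -ltr_pdivlMr.
by have := normr_ge0 (S a (maxn N i.+1) - S b (maxn N i.+1)); lra.
Qed.

Lemma sign_bounded_basic : basic_sequence y.
Proof.
move=> z /expansion_exists[a az]; exists a; split=> // b; exact: expansion_unique.
Qed.

Lemma rearranged_sum a (pi : nat -> nat) e : injective pi ->
  exists A : pred nat, exists B, (forall i, (i < e)%N -> A (pi i)) /\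
   forall B', (B <= B')%N -> \sum_(0 <= i < e) a (pi i) *: y (pi i) =
    \sum_(0 <= j < B' | A j) a j *: y j.
Proof.
move=> ipi; exists (fun j => j \in [seq pi i | i <- iota 0 e]).
exists (\max_(i < e) pi i).+1; split.
  by move=> i ie; apply: map_f; rewrite mem_iota.
move=> B hB; rewrite -[RHS]big_filter -(big_map pi xpredT (fun j => a j *: y j)).
apply: perm_big; rewrite /index_iota !subn0; apply: uniq_perm.
- by rewrite map_inj_uniq // iota_uniq.
- by rewrite filter_uniq // iota_uniq.
move=> j; rewrite mem_filter mem_iota add0n.
case: mapP => [[i]|//]; rewrite mem_iota add0n => /= ie ->; symmetry.
apply: leq_trans hB; rewrite ltnS.
exact: (leq_bigmax (F := fun i : 'I_e => pi i) (Ordinal ie)).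
Qed.

(** Once a rearranged partial sum contains the first d terms, its other terms
form a subset of a tail of the original series, and subset_sum_le bounds
them. *)
Lemma sign_bounded_unconditional : unconditional_basic_sequence y.
Proof.
split; first exact: sign_bounded_basic.
move=> a /cvg_ex[z az] pi [rho piK rhoK]; apply/cvg_ex; exists z.
apply/cvgrPdist_lt => e e0.
pose c := 2 * (D + 1); have c0 : 0 < c by rewrite mulr_gt0 // ltr_wpDl.
have [d _ hd] := (iffLR (cvgrPdist_lt _ _) az) _ (divr_gt0 e0 c0).
have far N : (d <= N)%N -> c * `|z - S a N| < e.
  by move=> dN; rewrite mulrC -ltr_pdivlMr //; apply: hd.
near=> N.
(* The rearranged sum is a sum over A, which contains all j < d. *)
have [A [B [AN AB]]] := rearranged_sum a N (can_inj piK).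
have Ad j : (j < d)%N -> A j.
  move=> jd; rewrite -(rhoK j); apply: AN; apply: leq_ltn_trans (_ : \max_(i < d) rho i < N)%N.
    exact: (leq_bigmax (F := fun i : 'I_d => rho i) (Ordinal jd)).
  by near: N; exact: nbhs_infty_gt.
have E1 : expansion (a \o pi) (y \o pi) N = \sum_(0 <= i < N) a (pi i) *: y (pi i) by [].
rewrite E1 (AB (maxn B d)) ?leq_maxl //.
have dB : (d <= maxn B d)%N by exact: leq_maxr.
have -> : \sum_(0 <= j < maxn B d | A j) a j *: y j = S a d +
    \sum_(0 <= j < maxn B d | A j) (if (j < d)%N then 0 else a j) *: y j.
  rewrite /S (big_nat_widen _ _ _ _ _ dB) big_mkcond [in RHS]big_mkcond /=.
  rewrite [X in _ = _ + X]big_mkcond -big_split; apply: eq_bigr => j _ /=.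
  case: ltnP => [/Ad ->|_]; first by rewrite scale0r addr0.
  by rewrite add0r.
have : `|\sum_(0 <= j < maxn B d | A j) (if (j < d)%N then 0 else a j) *: y j|
    <= D * `|S a (maxn B d) - S a d|.
  apply: le_trans (subset_sum_le _ _ _) _; rewrite ler_wpM2l //.
  rewrite le_eqVlt; apply/orP; left; apply/eqP; congr `|_|.
  rewrite /S [X in _ = X - _](big_cat_nat (leq0n d) dB) //= addrAC subrr add0r.
  rewrite (big_cat_nat (leq0n d) dB) //= big_nat big1 ?add0r => [|j /= ->]; last by rewrite scale0r.
  rewrite big_nat [RHS]big_nat; apply: eq_bigr => j /andP[dj _].
  by rewrite ltnNge dj.
set V := \sum_(0 <= j < maxn B d | A j) _ => hV.
rewrite opprD addrA; apply: le_lt_trans (ler_normB _ _) _.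
have h1 := far _ (leqnn d); have h2 := far _ dB.
have h3 : `|S a (maxn B d) - S a d| <= `|z - S a (maxn B d)| + `|z - S a d|.
  by apply: le_trans (ler_distD z _ _) _; rewrite distrC.
have h4 : D * `|S a (maxn B d) - S a d| <= D * (`|z - S a (maxn B d)| + `|z - S a d|).
  by rewrite ler_wpM2l.
rewrite /c in h1 h2; have n1 := normr_ge0 (z - S a d).
have n2 := normr_ge0 (z - S a (maxn B d)); nra.
Unshelve. all: by end_near. Qed.

End UnconditionalBasic.

Lemma max_norm_index (R : realType) (a : nat -> R) d : (0 < d)%N ->
  exists2 k, (k < d)%N & forall i, (i < d)%N -> `|a i| <= `|a k|.
Proof.
elim: d => // -[_ _|d /(_ isT)[k kd hk] _].
  by exists 0%N => // -[].
have [le|lt] := leP `|a d.+1| `|a k|; [exists k|exists d.+1] => //.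
- by rewrite ltnW.
- by move=> i; rewrite ltnS leq_eqVlt => /orP[/eqP ->|/hk].
- move=> i; rewrite ltnS leq_eqVlt => /orP[/eqP ->//|/hk] h.
  exact: le_trans h (ltW lt).
Qed.

(** If |a_k| is the largest coefficient, the sums before and after the change
of the sign of a_k differ by 2 a_k y_k, so that
2 |a_k| <= (1 + C) |sum a_i y_i| + |a_k|. *)
Lemma almost_sign_invariant_unconditional (R : realType)
  (X : normedModType R) (y : nat -> X) (C : R) :
  0 <= C -> (forall i, `|y i| = 1) ->
  (forall d (a : nat -> R) (e : nat -> bool) M, 0 <= M ->
    (forall i, (i < d)%N -> `|a i| <= M) ->
    `|partial_sum y (fun i => (-1) ^+ e i * a i) d| <= C * `|partial_sum y a d| + M) ->
  unconditional_basic_sequence y.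
Proof.
move=> C0 y1 H; apply: (@sign_bounded_unconditional _ _ _ (2 * C + 1)) => //.
  by rewrite addr_ge0 // mulr_ge0.
move=> [|d] a e; first by rewrite /partial_sum !big_geq // normr0 mulr0.
have [k kd hk] := max_norm_index a (ltn0Sn d).
have h1 := H _ _ (fun i => i == k) _ (normr_ge0 _) hk.
have h2 := H _ _ e _ (normr_ge0 _) hk.
have h3 : partial_sum y a d.+1 - partial_sum y (fun i => (-1) ^+ (i == k) * a i) d.+1
    = (2 * a k) *: y k.
  rewrite -partial_sumB /partial_sum.
  have -> : (2 * a k) *: y k = \sum_(0 <= i < d.+1 | i == k) (2 * a i) *: y i.
    by rewrite big_nat1_eq kd.
  rewrite [RHS]big_mkcond; apply: eq_bigr => i _; rewrite !fctE.
  case: eqP => _ /=; rewrite ?expr1 ?expr0.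
    by congr (_ *: _); ring.
  by rewrite mul1r subrr scale0r.
have h4 : 2 * `|a k| <= `|partial_sum y a d.+1| + (C * `|partial_sum y a d.+1| + `|a k|).
  have -> : 2 * `|a k| = `|(2 * a k) *: y k| by rewrite normrZ y1 mulr1 normrM ger0_norm.
  rewrite -h3.
  by apply: le_trans (ler_normB _ _) _; rewrite lerD2l.
lra.
Qed.

(** * Vectors without head in infinite dimensional subspaces *)
Section Subspaces.
Variables (R : realType) (X : normedModType R).
Implicit Types Y : set X.

Definition subspace Y := Y 0 /\ forall (a : R) u v, Y u -> Y v -> Y (a *: u + v).

Lemma subspace_scale Y a u : subspace Y -> Y u -> Y (a *: u).
Proof. by case=> Y0 Yl Yu; rewrite -[_ *: _]addr0; apply: Yl. Qed.

Lemma subspace_partial_sum Y (w : nat -> X) a d : subspace Y ->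
  (forall i, Y (w i)) -> Y (partial_sum w a d).
Proof.
move=> [Y0 Yl] Yw; rewrite /partial_sum; apply: big_rec => // i z _ Yz; exact: Yl.
Qed.

(** A hyperplane of Y spanned by finitely many vectors would, with one more
vector, span Y. *)
Lemma kernel_infinite Y (l : X -> R) : subspace Y -> ~ finite_dimensional Y ->
  (forall a u v, l (a *: u + v) = a * l u + l v) ->
  subspace (Y `&` [set w | l w = 0]) /\
  ~ finite_dimensional (Y `&` [set w | l w = 0]).
Proof.
move=> [Y0 Yl] nY lin; split.
  split=> [|a u v [Yu lu] [Yv lv]].
    split=> //=; have := lin 0 0 0; rewrite scale0r addr0 mul0r add0r.
    by have := lin (-1) 0 0; rewrite scaler0 addr0; lra.
  by split; [exact: Yl|rewrite /= lin lu lv mulr0 addr0].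
case=> d [v [Yv hv]]; apply: nY.
have [[v0 Yv0 lv0]|h] := pselect (exists2 v0, Y v0 & l v0 != 0); last first.
  exists d, v; split=> [i|z Yz]; first by case: (Yv i).
  apply: hv; split=> //=; apply: contrapT => /eqP lz; apply: h; by exists z.
exists d.+1, (fun i => oapp v v0 (unlift ord0 i)); split=> [i|z Yz].
  by case: unliftP => //= j _; case: (Yv j).
have [|a ha] := hv (- (l z / l v0) *: v0 + z).
  by split; [exact: Yl|rewrite /= lin mulNr divfK // addNr].
exists (fun i => oapp a (l z / l v0) (unlift ord0 i)).
rewrite big_ord_recl unlift_none /=.
under eq_bigr => i _ do rewrite liftK /=.
by rewrite -ha scaleNr addrA subrr add0r.
Qed.

End Subspaces.

Section Space.
Variables (R : realType) (m n s : nat -> nat).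
Hypothesis Hparam : admissible_parameters m n s.
Variable sigma : block_seq R -> nat.
Hypothesis Hsigma : coding_function m sigma.
Variables (X : completeNormedModType R) (iota : (nat -> R) -> X).
Hypothesis Hcompl : is_completion (normK m n sigma) iota.
Implicit Types (u x : nat -> R) (w z : X) (Y : set X).

Local Notation normK := (normK m n sigma).
Local Notation small_averages := (small_averages m n).

Lemma iota_lin (a : R) x u : c00 x -> c00 u -> iota (a *: x + u) = a *: iota x + iota u.
Proof. by case: Hcompl => h _ _; apply: h. Qed.

Lemma norm_iota x : c00 x -> `|iota x| = normK x.
Proof. by case: Hcompl => _ h _; apply: h. Qed.

Lemma iota0 : iota 0 = 0.
Proof.
have := iota_lin 1 (@c00_0 R) (@c00_0 R); rewrite !scale1r addr0 => h.
by apply: (addrI (iota 0)); rewrite addr0 -h.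
Qed.

Lemma iotaB x u : c00 x -> c00 u -> iota (x - u) = iota x - iota u.
Proof. by move=> cx cu; rewrite addrC -scaleN1r iota_lin // scaleN1r addrC. Qed.

Lemma iota_partial_sum (u : nat -> nat -> R) a d : (forall i, c00 (u i)) ->
  iota (\sum_(0 <= i < d) a i *: u i) = partial_sum (iota \o u) a d.
Proof.
move=> cu; rewrite /partial_sum; elim: d => [|d IH]; first by rewrite !big_geq // iota0.
rewrite !big_nat_recr //= addrC iota_lin ?IH // 1?addrC //.
by apply: c00_sum => i; apply: c00_Z.
Qed.

Lemma iota_dense w e : 0 < e -> exists2 u, c00 u & `|w - iota u| < e.
Proof.
case: Hcompl => _ _ dn e0; have [||z [wz [u cu uz]]] := dn (ball w e).
- by exists w; exact: ballxx.
- exact: ball_open.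
by exists u => //; rewrite uz; move: wz; rewrite -ball_normE.
Qed.

(** The coordinates are contractive on c00 and extend to the completion; the
extension is recorded by its distance to the coordinates of approximants. *)
Lemma coordinate_exists :
  exists coord : nat * X -> R, forall p u, c00 u -> `|u p.1 - coord p| <= `|p.2 - iota u|.
Proof.
suff /choice[coord h] : forall p : nat * X, exists a : R,
    forall u, c00 u -> `|u p.1 - a| <= `|p.2 - iota u| by exists coord.
move=> [c w].
pose T := {u : nat -> R | `[< c00 u >]}.
have hT (t : T) : c00 (sval t) by apply/asboolP; exact: (svalP t).
have t0 : T by exists 0; apply/asboolP; exact: c00_0.
have [|a ha] := @approximable_value R T t0 (fun t => sval t c)
  (fun t => `|w - iota (sval t)|).
  move=> p q; apply: le_trans (ler_norm _) _.
  apply: (@le_trans _ _ `|(sval p - sval q) c|) => //.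
  apply: le_trans (coord_le_normK Hparam Hsigma c (c00_B (hT p) (hT q))) _.
  rewrite -norm_iota ?iotaB //; last exact: c00_B.
  by apply: le_trans (ler_distD w _ _) _; rewrite distrC.
exists a => u cu; have fu : `[< c00 u >] by apply/asboolP.
exact: (ha (exist _ u fu)).
Qed.

Lemma coordinate_linear (coord : nat * X -> R) :
  (forall p u, c00 u -> `|u p.1 - coord p| <= `|p.2 - iota u|) ->
  forall c (a : R) w z, coord (c, a *: w + z) = a * coord (c, w) + coord (c, z).
Proof.
move=> h c a w z; apply/eqP; rewrite -subr_eq0 -normr_le0.
apply/ler_addgt0Pr => e e0; rewrite add0r.
pose t := e / (2 * (`|a| + 1)).
have a1 : 0 < 2 * (`|a| + 1) by rewrite mulr_gt0 // ltr_wpDl.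
have t0 : 0 < t by rewrite divr_gt0.
have [[u cu hu] [v cv hv]] := (iota_dense w t0, iota_dense z t0).
have h1 := h (c, w) u cu; have h2 := h (c, z) v cv.
have h3 := h (c, a *: w + z) _ (c00_lin a cu cv); rewrite /= in h1 h2 h3.
have h4 : `|a *: w + z - iota (a *: u + v)| <= `|a| * t + t.
  rewrite iota_lin // opprD addrACA -scalerBr.
  apply: le_trans (ler_normD _ _) _; rewrite normrZ; apply: lerD; last exact: ltW.
  by apply: ler_wpM2l => //; exact: ltW.
have h5 : `|a * (u c - coord (c, w))| <= `|a| * t.
  by rewrite normrM ler_wpM2l //; apply: le_trans h1 (ltW hu).
have h6 : `|v c - coord (c, z)| <= t by apply: le_trans h2 (ltW hv).
have -> : coord (c, a *: w + z) - (a * coord (c, w) + coord (c, z)) =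
   - ((a *: u + v) c - coord (c, a *: w + z)) + a * (u c - coord (c, w))
   + (v c - coord (c, z)).
  rewrite -[(a *: u + v) c]/(a * u c + v c); ring.
have et : 2 * (`|a| + 1) * t = e by rewrite mulrC divfK // gt_eqF.
apply: le_trans (ler_normD _ _) _.
have := ler_normD (- ((a *: u + v) c - coord (c, a *: w + z))) (a * (u c - coord (c, w))).
rewrite normrN; lra.
Qed.

Lemma tail_restrict N u c : (u \_ [set c | (N < c)%N]) c = if (c <= N)%N then 0 else u c.
Proof.
rewrite patchE; case: (leqP c N) => cN; last by rewrite mem_set.
by rewrite memNset //=; apply/negP; rewrite -leqNgt.
Qed.

Lemma drop_head N u : c00 u ->
  normK (u - u \_ [set c | (N < c)%N]) <= \sum_(c < N.+1) `|u c|.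
Proof.
move=> cu; have hc c : (u - u \_ [set c | (N < c)%N]) c = if (c <= N)%N then u c else 0.
  by rewrite !fctE tail_restrict; case: ifP; rewrite ?subr0 ?subrr.
apply: le_trans (normK_le_sum Hparam Hsigma (N := N.+1) _ _) _.
- by rewrite hc /= cu.1.
- by move=> c; rewrite hc leqNgt => /negPf; rewrite ltnS => ->.
by apply: ler_sum => c _; rewrite hc -ltnS ltn_ord.
Qed.

(** Some unit vector w of Y is in the kernel of the first N + 1 coordinates.
The first coordinates of an approximant u of w are then small, and removing
them moves u by at most their sum. *)
Lemma head_free_vector Y N e : subspace Y -> ~ finite_dimensional Y -> 0 < e ->
  exists w u, [/\ Y w, `|w| = 1, c00 u, forall c, (c <= N)%N -> u c = 0 &
                  `|w - iota u| <= e].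
Proof.
move=> sY nY e0; have [coord hc] := coordinate_exists.
have lin c := coordinate_linear hc c.
have [Z [sZ nZ ZY Z0]] : exists Z : set X, [/\ subspace Z, ~ finite_dimensional Z,
    Z `<=` Y & forall w c, Z w -> (c <= N)%N -> coord (c, w) = 0].
  have step k (Z : set X) : subspace Z -> ~ finite_dimensional Z ->
    subspace (Z `&` [set w | coord (k, w) = 0]) /\
    ~ finite_dimensional (Z `&` [set w | coord (k, w) = 0]).
    by move=> sZ nZ; apply: (kernel_infinite sZ nZ (lin k)).
  elim: N => [|N [Z [sZ nZ ZY Z0]]].
    have [sZ nZ] := step 0%N Y sY nY; exists (Y `&` [set w | coord (0%N, w) = 0]).
    by split=> // w c [_ /= w0]; rewrite leqn0 => /eqP ->.
  have [sZ' nZ'] := step N.+1 Z sZ nZ.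
  exists (Z `&` [set w | coord (N.+1, w) = 0]).
  split=> // [w [/ZY]//|w c [Zw /= w0]]; rewrite leq_eqVlt => /orP[/eqP ->//|].
  by rewrite ltnS; apply: Z0.
have [z Zz z0] : exists2 z, Z z & z != 0.
  apply: contrapT => h; apply: nZ; exists 0%N, (fun=> 0); split=> [[]//|z Zz].
  exists (fun=> 0); rewrite big_ord0; apply/eqP/negPn/negP => z0; apply: h.
  by exists z.
pose w := `|z|^-1 *: z; have Zw : Z w by apply: subspace_scale.
have w1 : `|w| = 1 by rewrite normrZ normfV normr_id mulVf // normr_eq0.
pose t := e / N.+2%:R; have t0 : 0 < t by rewrite divr_gt0.
have [u cu hu] := iota_dense w t0.
exists w, (u \_ [set c | (N < c)%N]); split=> //.
- exact: ZY.
- exact: c00_restrict.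
- by move=> c cN; rewrite tail_restrict cN.
have cr := c00_restrict [set c | (N < c)%N] cu.
apply: le_trans (ler_distD (iota u) _ _) _.
rewrite -iotaB // norm_iota; last exact: c00_B.
have : normK (u - u \_ [set c | (N < c)%N]) <= t *+ N.+1.
  apply: le_trans (drop_head N cu) _.
  rewrite -[X in _ *+ X](card_ord N.+1) -sumr_const; apply: ler_sum => c _.
  have := hc (c : nat, w) u cu; rewrite /= Z0 // ?subr0 => [h|]; last by rewrite -ltnS.
  exact: le_trans h (ltW hu).
have : t *+ N.+2 = e by rewrite -mulr_natr divfK // pnatr_eq0.
by rewrite mulrS; lra.
Qed.

(** Each vector is chosen to vanish up to the end NN k of the previous ones; the
colour of c is the number of ends NN 1, NN 2, .. which are at most c. *)
Lemma block_sequence (P : nat -> X -> (nat -> R) -> Prop) N0 :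
  (forall N k, exists w u, [/\ P k w u, c00 u & forall c, (c <= N)%N -> u c = 0]) ->
  exists (w : nat -> X) (u : nat -> nat -> R) (col : nat -> nat),
    {homo col : a b / (a <= b)%N} /\
    forall k, [/\ P k (w k) (u k), c00 (u k), coloured col k (u k) &
                  forall c, (c <= N0)%N -> u k c = 0].
Proof.
move=> H; have /choice[F hF] : forall p : nat * nat, exists q : X * (nat -> R) * nat,
    [/\ P p.2 q.1.1 q.1.2, c00 q.1.2, forall c, (c <= p.1)%N -> q.1.2 c = 0 &
        forall c, (q.2 <= c)%N -> q.1.2 c = 0].
  move=> [N k]; have [w [u [h1 h2 h3]]] := H N k.
  by have [M hM] := c00_eventually0 h2; exists (w, u, M).
pose NN := fix NN k := if k is k'.+1 then maxn (NN k').+1 (F (NN k', k')).2 else N0.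
have NS k : (NN k < NN k.+1)%N by rewrite /= leq_max leqnn.
have Nmono : {homo NN : a b / (a <= b)%N}.
  by apply: homo_leq => //; [exact: leq_trans|move=> k; exact: ltnW].
have Nk k : (k <= NN k)%N by elim: k => // k IH; apply: leq_ltn_trans IH (NS k).
exists (fun k => (F (NN k, k)).1.1), (fun k => (F (NN k, k)).1.2).
exists (fun c => \sum_(0 <= i < c) (NN i.+1 <= c)%N)%N; split.
  move=> a b ab; rewrite [leqRHS](big_cat_nat (leq0n a) ab) //=.
  apply: leq_trans (leq_addr _ _); apply: leq_sum => i _.
  by case: (leqP (NN i.+1) a) => // /leq_trans -> //.
move=> k; have [h1 h2 h3 h4] := hF (NN k, k); split=> //.
  move=> c uc; have kc : (NN k < c)%N.
    by rewrite ltnNge; apply: contra uc => /h3 ->.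
  have ck : (c < NN k.+1)%N.
    rewrite ltnNge; apply: contra uc => hc; apply/eqP/h4; apply: leq_trans hc.
    by rewrite /= leq_maxr.
  have kc' : (k <= c)%N by apply: leq_trans (Nk k) (ltnW kc).
  rewrite (big_cat_nat (leq0n k) kc') //= [X in (_ + X)%N]big_nat.
  rewrite [X in (_ + X)%N]big1 => [|i /andP[ki _]]; last first.
    by rewrite leqNgt (leq_trans ck) // -[(NN k.+1 <= _)%N]/(NN k.+1 <= NN i.+1)%N Nmono.
  rewrite addn0 big_nat (eq_bigr (fun=> 1%N)) => [|i /andP[_ ik]].
    by rewrite -big_nat sum_nat_const_nat subn0 muln1.
  have -> // : (NN i.+1 <= c)%N.
  by apply: leq_trans (ltnW kc); apply: Nmono.
by move=> c cN; apply: h3; apply: leq_trans cN (Nmono 0%N k _).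
Qed.

Lemma geometric_sum_le d : \sum_(0 <= i < d) 2^-1 ^+ i.+1 <= 1 :> R.
Proof.
suff -> : \sum_(0 <= i < d) 2^-1 ^+ i.+1 = 1 - 2^-1 ^+ d :> R.
  by rewrite gerBl exprn_ge0.
elim: d => [|d IH]; first by rewrite big_geq // expr0 subrr.
by rewrite big_nat_recr //= IH exprS; field.
Qed.

Lemma weighted_sum_le (a b : nat -> R) d M eta : 0 <= eta -> 0 <= M ->
  (forall i, (i < d)%N -> `|a i| <= M) ->
  (forall i, b i <= eta * 2^-1 ^+ i.+1) ->
  \sum_(0 <= i < d) `|a i| * b i <= eta * M.
Proof.
move=> eta0 M0 aM hb; apply: (@le_trans _ _ (eta * M * \sum_(0 <= i < d) 2^-1 ^+ i.+1)).
  rewrite mulr_sumr big_nat [leRHS]big_nat; apply: ler_sum => i /= id.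
  apply: le_trans (_ : `|a i| * (eta * 2^-1 ^+ i.+1) <= _).
    by apply: ler_wpM2l.
  rewrite mulrA [`|a i| * eta]mulrC.
  apply: ler_wpM2r; first by rewrite exprn_ge0.
  by apply: ler_wpM2l => //; exact: aM.
by rewrite -[leRHS]mulr1; apply: ler_wpM2l; [rewrite mulr_ge0|exact: geometric_sum_le].
Qed.

(** * Block sequences and the two cases *)
Section Blocks.
Variables (w : nat -> X) (u : nat -> nat -> R) (col : nat -> nat) (eta : R).
Hypothesis eta0 : 0 <= eta.
Hypothesis cu : forall k, c00 (u k).
Hypothesis uk : forall k, coloured col k (u k).
Hypothesis wu : forall k, `|w k - iota (u k)| <= eta * 2^-1 ^+ k.+1.

Local Notation U a d := (\sum_(0 <= i < d) a i *: u i).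
Local Notation W := (partial_sum w).
Local Notation flip e a := (fun i : nat => (-1) ^+ (e i : bool) * a i).

Lemma c00_blocks (a : nat -> R) d : c00 (U a d).
Proof. by apply: c00_sum => i; apply: c00_Z. Qed.

Lemma blocks_close (a : nat -> R) d M : 0 <= M ->
  (forall i, (i < d)%N -> `|a i| <= M) -> `|W a d - iota (U a d)| <= eta * M.
Proof.
move=> M0 aM; rewrite iota_partial_sum // /partial_sum -sumrB.
apply: le_trans (ler_norm_sum _ _ _) _.
apply: le_trans (weighted_sum_le eta0 M0 aM wu).
by apply: ler_sum => i _; rewrite -scalerBr normrZ.
Qed.

Lemma flip_le (a : nat -> R) e d M :
  (forall i, (i < d)%N -> `|a i| <= M) -> forall i, (i < d)%N -> `|flip e a i| <= M.
Proof. by move=> aM i id; rewrite normrM normr_sign mul1r; exact: aM. Qed.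

(** At a coordinate c only the block of the colour of c can be nonzero. *)
Lemma norm_blocks_flip (a : nat -> R) e d c : `|(U (flip e a) d) c| = `|(U a d) c|.
Proof.
have -> : (U (flip e a) d) c = (-1) ^+ e (col c) * (U a d) c.
  rewrite !fct_sumE mulr_sumr; apply: eq_bigr => i _.
  change ((-1) ^+ e i * a i * u i c = (-1) ^+ e (col c) * (a i * u i c)).
  have [->|/(@uk i) ->] := eqVneq (u i c) 0; first by rewrite !mulr0.
  by rewrite mulrA.
by rewrite normrM normr_sign mul1r.
Qed.

Lemma average_blocks_flip p (t : 'I_(n p) -> nat) (a : nat -> R) e d :
  average m t (U (flip e a) d) = average m t (U a d).
Proof.
by congr (_ * _); apply: eq_bigr => l _; apply: norm_blocks_flip.
Qed.

(** A functional f norming the sum with the signs changed is compared, through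
sign_change_K, with a functional which takes nearly the same value at the
original sum. *)
Lemma normK_blocks_flip (a : nat -> R) e d M :
  {homo col : b c / (b <= c)%N} ->
  (forall k, small_averages (u k) (eta * 2^-1 ^+ k.+1)) -> 0 <= M ->
  (forall i, (i < d)%N -> `|a i| <= M) ->
  normK (U (flip e a) d) <= normK (U a d) + eta * M.
Proof.
move=> cm su M0 aM; apply: (normK_le Hparam Hsigma) => [|f Kf]; first exact: c00_blocks.
have [g Kg hg] := sign_change_K Hparam Hsigma e cm Kf.
have hp (b : nat -> R) h : pairing h (U b d) = \sum_(0 <= i < d) b i * pairing h (u i).
  rewrite pairing_sumr; last by move=> i; apply: c00_Z.
  by apply: eq_bigr => i _; rewrite pairingZr.
have := pairing_le_normK Hparam Hsigma (c00_blocks a d) Kg.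
move=> /(le_trans (ler_norm _)) h1.
apply: le_trans (_ : pairing g (U a d) + eta * M <= _); last by rewrite lerD2r.
rewrite -lerBlDl !hp -sumrB.
apply: le_trans (weighted_sum_le (b := fun i => eta * 2^-1 ^+ i.+1) eta0 M0 aM _) => //.
apply: ler_sum => i _; apply: le_trans (ler_norm _) _.
rewrite -mulrA mulrCA -mulrBr normrM ler_wpM2l // distrC.
exact: (hg i).
Qed.

End Blocks.

(** With eta = 1/3, the two perturbations and the sign change cost together at
most the maximum of the coefficients. *)
Lemma saturated_small_averages Y : subspace Y ->
  (forall N e, 0 < e -> exists w u, [/\ Y w, `|w| = 1, c00 u,
     forall c, (c <= N)%N -> u c = 0 & `|w - iota u| <= e /\ small_averages u e]) ->
  exists2 y, (forall k, Y (y k)) & unconditional_basic_sequence y.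
Proof.
move=> sY H; pose eta : R := 3^-1.
have eta0 : 0 <= eta by rewrite invr_ge0.
pose P k w u := [/\ Y w, `|w| = 1, `|w - iota u| <= eta * 2^-1 ^+ k.+1 &
  small_averages u (eta * 2^-1 ^+ k.+1)].
have [|w [u [col [cm hP]]]] := @block_sequence P 0%N.
  move=> N k; have ek : 0 < eta * 2^-1 ^+ k.+1 by rewrite mulr_gt0 ?invr_gt0 ?exprn_gt0.
  by have [w [u [h1 h2 h3 h4 [h5 h6]]]] := H N _ ek; exists w, u.
have Pk k : P k (w k) (u k) by case: (hP k).
have cu k : c00 (u k) by case: (hP k).
have uk k : coloured col k (u k) by case: (hP k).
have wu k : `|w k - iota (u k)| <= eta * 2^-1 ^+ k.+1 by case: (Pk k).
exists w => [k|]; first by case: (Pk k).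
apply: (almost_sign_invariant_unconditional ler01) => [k|d a e M M0 aM]; first by case: (Pk k).
have h1 := blocks_close eta0 cu wu M0 aM.
have h2 := blocks_close eta0 cu wu M0 (flip_le e aM).
have [|h3 _] := (@normK_blocks_flip u col eta eta0 cu uk a e d M cm _ M0 aM, tt).
  by move=> k; case: (Pk k).
rewrite -!norm_iota in h3; try exact: c00_blocks.
set A := partial_sum w a d in h1 *; set A' := partial_sum w _ d in h2 *.
set V := \sum_(0 <= i < d) a i *: u i in h1 h3.
set V' := \sum_(0 <= i < d) _ *: u i in h2 h3.
have h4 : `|A'| <= `|A' - iota V'| + `|iota V'|.
  by rewrite -[X in `|X| <= _](subrK (iota V')) ler_normD.
have h5 : `|iota V| <= `|A - iota V| + `|A|.
  by rewrite -[X in `|X| <= _](subrK A) [`|A - _|]distrC ler_normD.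
have : eta * M = M / 3 by rewrite mulrC.
lra.
Qed.

(** For a combination A' of the w_k with changed signs, close to the block
vector V', the hypothesis gives e0 * |A'| <= average of V' up to the
perturbation; the average is that of the original block vector V, and is at
most the norm of V. *)
Lemma saturated_large_averages Y N0 e0 : subspace Y -> ~ finite_dimensional Y ->
  0 < e0 ->
  (forall w u, Y w -> `|w| = 1 -> c00 u -> (forall c, (c <= N0)%N -> u c = 0) ->
     `|w - iota u| <= e0 -> ~ small_averages u e0) ->
  exists2 y, (forall k, Y (y k)) & unconditional_basic_sequence y.
Proof.
move=> sY nY e0_gt0 H; have eta0 := ltW e0_gt0.
pose P k w u := [/\ Y w, `|w| = 1 & `|w - iota u| <= e0 * 2^-1 ^+ k.+1].
have [|w [u [col [cm hP]]]] := @block_sequence P N0.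
  move=> N k; have ek : 0 < e0 * 2^-1 ^+ k.+1 by rewrite mulr_gt0 ?exprn_gt0.
  by have [w [u [h1 h2 h3 h4 h5]]] := head_free_vector N sY nY ek; exists w, u.
have Pk k : P k (w k) (u k) by case: (hP k).
have cu k : c00 (u k) by case: (hP k).
have uk k : coloured col k (u k) by case: (hP k).
have u0 k c : (c <= N0)%N -> u k c = 0 by case: (hP k) => _ _ _; apply.
have wu k : `|w k - iota (u k)| <= e0 * 2^-1 ^+ k.+1 by case: (Pk k).
have Yw k : Y (w k) by case: (Pk k).
exists w => //.
have e1 : 0 <= e0^-1 by rewrite invr_ge0.
apply: (almost_sign_invariant_unconditional e1) => [k|d a e M M0 aM]; first by case: (Pk k).
have h1 := blocks_close eta0 cu wu M0 aM.
have h2 := blocks_close eta0 cu wu M0 (flip_le e aM).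
set A := partial_sum w a d in h1 *; set A' := partial_sum w _ d in h2 *.
set V := \sum_(0 <= i < d) _ in h1; set V' := \sum_(0 <= i < d) _ in h2.
have cV : c00 V by exact: c00_blocks.
have cV' : c00 V' by exact: c00_blocks.
have [A'0|A'0] := eqVneq A' 0.
  by rewrite A'0 normr0 addr_ge0 // mulr_ge0.
have nA' : 0 < `|A'| by rewrite normr_gt0.
suff : e0 * `|A'| <= `|A| + e0 * M.
  by rewrite -[X in _ -> X <= _](mulKf (lt0r_neq0 e0_gt0)) => h;
     rewrite -[M in leRHS](mulKf (lt0r_neq0 e0_gt0)) -mulrDr ler_wpM2l.
rewrite leNgt; apply/negP => lt; apply: (H (`|A'|^-1 *: A') (`|A'|^-1 *: V')).
- by apply: subspace_scale => //; apply: subspace_partial_sum.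
- by rewrite normrZ normfV normr_id mulVf // gt_eqF.
- exact: c00_Z.
- move=> c cN; rewrite fctE /V' fct_sumE big1 ?scaler0 // => i _.
  by rewrite !fctE u0 // scaler0.
- have -> : iota (`|A'|^-1 *: V') = `|A'|^-1 *: iota V'.
    by rewrite -[_ *: V']addr0 iota_lin ?iota0 ?addr0 //; exact: c00_0.
  rewrite -scalerBr normrZ normfV normr_id mulrC ler_pdivrMr //.
  apply: le_trans h2 _; apply: le_trans (ltW lt); rewrite lerDr //.
move=> p t p0 ep it t0.
have -> : average m t (`|A'|^-1 *: V') = `|A'|^-1 * average m t V'.
  rewrite /average mulrCA; congr (_ * _); rewrite mulr_sumr; apply: eq_bigr => l _.
  by rewrite fctE [_ *: _]/(_ * _) normrM normfV normr_id.
rewrite mulrC ler_pdivrMr //.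
have <- : average m t V = average m t V' by rewrite (average_blocks_flip uk).
apply: le_trans (average_le_normK Hparam Hsigma cV p0 ep it t0) _.
rewrite -norm_iota //; apply: le_trans (ltW lt).
have -> : iota V = A - (A - iota V) by rewrite subKr.
by apply: le_trans (ler_normB _ _) _; rewrite lerD2l.
Qed.

Lemma space_unconditionally_saturated : unconditionally_saturated X.
Proof.
move=> Y sY _ nY; have {}sY : subspace Y.
  case: sY => Y0 Yl; split=> [|a x z Yx Yz]; first by rewrite inE in Y0.
  by have := Yl a x z; rewrite !inE; apply.
have [hA|hB] := pselect (forall N e, 0 < e -> exists w u, [/\ Y w, `|w| = 1, c00 u,
     forall c, (c <= N)%N -> u c = 0 & `|w - iota u| <= e /\ small_averages u e]).
  exact: saturated_small_averages.
have [N [e [e0 he]]] : exists N e, 0 < e /\ forall w u, Y w -> `|w| = 1 -> c00 u ->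
   (forall c, (c <= N)%N -> u c = 0) -> `|w - iota u| <= e -> ~ small_averages u e.
  apply: contrapT => h; apply: hB => N e e0; apply: contrapT => h'; apply: h.
  exists N, e; split=> // w u Yw w1 cu uN wu su; apply: h'.
  by exists w, u.
exact: saturated_large_averages he.
Qed.

End Space.

Theorem mainTheorem1 (R : realType) (m n s : nat -> nat)
  (Hparam : admissible_parameters m n s)
  (sigma : block_seq R -> nat) (Hsigma : coding_function m sigma)
  (Xius : completeNormedModType R) (iota : (nat -> R) -> Xius)
  (Hcompl : is_completion (normK m n sigma) iota) :
  unconditionally_saturated Xius.
Proof.
exact: (space_unconditionally_saturated Hparam Hsigma Hcompl).
Qed.
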